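(* Let $\mathbb{S}^2$ be the unit sphere centered at the origin in $\mathbb{R}^3$, and let $\mathbb{S}^2 = S_1 \cup S_2 \cup S_3 \cup S_4$ be an orthogonal 4-coloring of $\mathbb{S}^2$. Then the coloring is octahedral if and only if every color class $S_i$ ($i=1,2,3,4$) has a dominating set $D_i$.
   Context: A $k$-coloring of $\mathbb{S}^2$ is a partition of $\mathbb{S}^2$ into $k$ non-empty parts $S_1,\dots,S_k$ (the color classes). It is orthogonal if $u\cdot v\neq 0$ for every pair $u,v$ belonging to the same color class ($u\cdot v$ the standard dot product). A regular octahedron is the convex hull of $\{\pm u_1,\pm u_2,\pm u_3\}$ where $u_1,u_2,u_3$ is an orthonormal basis of $\mathbb{R}^3$. For $S\subset\mathbb{S}^2$, let $\ell(S)$ be the set of lines through the origin and a point of $S$; $S$ is octahedral if all lines in $\ell(S)$ pass through the closure of two opposite faces of a regular octahedron (centered at the origin). A 4-coloring is octahedral if each color class is octahedral. A non-empty open set $D\subset\mathbb{S}^2$ is a dominating set of $S\subset\mathbb{S}^2$ (or dominates $S$) if every great circle of $\mathbb{S}^2$ that intersects $D$ also intersects $S$. *)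

(* Defs.v *)
From HB Require Import structures.
From mathcomp Require Import all_boot all_order all_algebra.
From mathcomp Require Import all_classical all_reals topology normedtype convex.

Set Implicit Arguments.
Unset Strict Implicit.
Unset Printing Implicit Defensive.

Import Order.TTheory GRing.Theory Num.Theory.
Import numFieldNormedType.Exports.

Local Open Scope classical_set_scope.
Local Open Scope ring_scope.

Definition dot (R : realType) (u v : 'rV[R]_3) : R := (u *m v^T) 0 0.

(* The library norm on row vectors is the sup norm (with the usual topology),
   so the Euclidean sphere is given through the dot product. *)
Definition sphere (R : realType) : set 'rV[R]_3 := [set x | dot x x = 1].

(* [partition] includes non-emptiness of all the parts. *)
Definition is_coloring (R : realType) (k : nat) (S : 'I_k -> set 'rV[R]_3) :
  Prop := partition setT S (@sphere R).

Definition orthogonal_coloring (R : realType) (k : nat)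
    (S : 'I_k -> set 'rV[R]_3) : Prop :=
  is_coloring S /\ forall i u v, S i u -> S i v -> dot u v != 0.

Definition convex_hull (R : realType) (A : set 'rV[R]_3) : set 'rV[R]_3 :=
  smallest (@convex_set R 'rV[R]_3) A.

(* In dimension 3 an orthonormal triple is automatically a basis. *)
Definition orthonormal_basis (R : realType) (u : 'I_3 -> 'rV[R]_3) : Prop :=
  forall i j, dot (u i) (u j) = (i == j)%:R.

Definition regular_octahedron (R : realType) (P : set 'rV[R]_3) : Prop :=
  exists u : 'I_3 -> 'rV[R]_3, orthonormal_basis u /\
    P = convex_hull (range u `|` range (fun i => - u i)).

(* F is a two-dimensional face of the convex body P: the intersection of P with
   a supporting plane, containing three affinely independent points. *)
Definition is_face (R : realType) (P F : set 'rV[R]_3) : Prop :=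
  (exists (a : 'rV[R]_3) (b : R), [/\ a != 0,
      forall x, P x -> dot a x <= b &
      F = P `&` [set x | dot a x = b]]) /\
  (exists p q r, [/\ F p, F q, F r & row_free (col_mx (q - p) (r - p))]).

(* P is meant to be centered at the origin. *)
Definition opposite_faces (R : realType) (P F G : set 'rV[R]_3) : Prop :=
  [/\ is_face P F, is_face P G & G = [set - x | x in F]].

Definition lines (R : realType) (S : set 'rV[R]_3) : set (set 'rV[R]_3) :=
  [set range (fun t : R => t *: x) | x in S].

(* Faces as defined above are already closed; [closure] makes the notion
   independent of that convention. *)
Definition octahedral (R : realType) (S : set 'rV[R]_3) : Prop :=
  exists P F G : set 'rV[R]_3, [/\ regular_octahedron P, opposite_faces P F G &
    forall L, lines S L -> L `&` closure F !=set0 /\ L `&` closure G !=set0].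

Definition octahedral_coloring (R : realType) (S : 'I_4 -> set 'rV[R]_3) :
  Prop := forall i, octahedral (S i).

Definition great_circle (R : realType) (C : set 'rV[R]_3) : Prop :=
  exists2 n : 'rV[R]_3, n != 0 & C = @sphere R `&` [set x | dot n x = 0].

(* Openness of D is relative to the sphere. *)
Definition dominates (R : realType) (D S : set 'rV[R]_3) : Prop :=
  [/\ D !=set0, D `<=` @sphere R, open (D : set (subspace (@sphere R))) &
    forall C, great_circle C -> C `&` D !=set0 -> C `&` S !=set0].

(* Main.v *)
Require Import Defs.
From mathcomp Require Import all_boot all_order all_algebra.
From mathcomp Require Import all_classical all_reals topology normedtype convex.
From mathcomp Require Import interval_inference ring lra.

(* Colors are first transported to lines through the origin.

   A dominating set D of a color class makes every d in D non-orthogonal to the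
   class, uniformly, so the class has a positive cone representation and a dual
   cone K with non-empty interior.  At a boundary point v of K with unit normal r,
   a nearby plane p^perp with p of some other color k meets neither color k nor,
   away from r, the color of K.  Only two colors are left there, and comparing
   p^perp with (p + t q)^perp, where p + t q also has color k, shows that the color
   of q + a s is invariant under a -> a (1 + t^2).  Since each color misses an open
   set of lines, in the limit the two quarter circles bounded by r and by v x r in
   v^perp carry two distinct constant colors.  A color class contains no orthogonal
   pair, hence two such quarter circles of the same color cannot contain both
   acute and obtuse pairs; from these sign conditions two normals at the same
   boundary point are orthogonal, boundary edges of K do not bend, and an edge
   starting from a corner of K has length at least pi/2.  So K contains an
   orthonormal frame and the class lies in a double octant.

   Conversely, if the four classes lie in double octants, three of the octants
   cannot cover the sphere: a generic great circle avoiding the first one would be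
   split by the other two into disjoint non-empty closed sets.  Hence each class
   contains a non-empty open set, which dominates it. *)

Import Order.TTheory GRing.Theory Num.Theory.
Import numFieldNormedType.Exports.

Local Open Scope classical_set_scope.
Local Open Scope ring_scope.

(** * Euclidean geometry of row vectors *)
Section Vectors.
Context {R : realType}.
Implicit Types (u v w x y p q r s : 'rV[R]_3) (a b eta : R).

(** Color classes are arbitrary sets, neither closed nor measurable, so continuity cannot propagate
    a color. Orthogonality can: where only two colors remain, a vector orthogonal to both [x] and
    [z] forces them to share a color. Each factor [1 + t^2] comes from such exchanges between the
    two planes, and a power of it reaches the open gap of some color because a single step is
    shorter than that gap. The price is that colors are known only on frames near the limit, and
    only away from the ends of the quarter circles. Hence statements about colors at a boundary
    point are quantified over all scales [eta], and what is extracted from them are strict sign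
    conditions, which survive small perturbations. The boundary of [K] is not assumed smooth or
    polyhedral; normals, tangents and colors are selected by compactness. Moreover a line may have
    two colors, since antipodal points may be colored differently: a color of lines is a relation
    that covers, is invariant under scaling, and contains no orthogonal pair. *)

Lemma dotE u v : dot u v = \sum_i u 0 i * v 0 i.
Proof. by rewrite /dot mxE; apply: eq_bigr => i _; rewrite mxE. Qed.

Lemma dotC u v : dot u v = dot v u.
Proof. by rewrite !dotE; apply: eq_bigr => i _; rewrite mulrC. Qed.

Lemma dotDl u v w : dot (u + v) w = dot u w + dot v w.
Proof. by rewrite /dot mulmxDl mxE. Qed.

Lemma dotZl a u w : dot (a *: u) w = a * dot u w.
Proof. by rewrite /dot -scalemxAl mxE. Qed.

Lemma dotNl u w : dot (- u) w = - dot u w.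
Proof. by rewrite -scaleN1r dotZl mulN1r. Qed.

Lemma dot0l w : dot 0 w = 0.
Proof. by rewrite /dot mul0mx mxE. Qed.

Lemma dotDr u v w : dot w (u + v) = dot w u + dot w v.
Proof. by rewrite dotC dotDl !(dotC w). Qed.

Lemma dotZr a u w : dot w (a *: u) = a * dot w u.
Proof. by rewrite dotC dotZl (dotC w). Qed.

Lemma dotNr u w : dot w (- u) = - dot w u.
Proof. by rewrite dotC dotNl (dotC w). Qed.

Lemma dot0r w : dot w 0 = 0.
Proof. by rewrite dotC dot0l. Qed.

Definition dotL := (dotDl, dotDr, dotZl, dotZr, dotNl, dotNr, dot0l, dot0r).

Lemma dotxx_ge0 u : 0 <= dot u u.
Proof. by rewrite dotE sumr_ge0 // => i _; rewrite -expr2 sqr_ge0. Qed.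

Lemma dotxx_eq0 u : (dot u u == 0) = (u == 0).
Proof.
apply/eqP/eqP => [|->]; last by rewrite dot0l.
rewrite dotE => /eqP; rewrite psumr_eq0 => [/allP h|i _]; last by rewrite -expr2 sqr_ge0.
apply/rowP => i; have := h i (mem_index_enum i).
by rewrite /= -expr2 sqrf_eq0 mxE => /eqP.
Qed.

Lemma dotxx_gt0 u : (0 < dot u u) = (u != 0).
Proof. by rewrite lt0r dotxx_ge0 andbT dotxx_eq0. Qed.

Lemma dot_neq0l u v : dot u v != 0 -> u != 0.
Proof. by apply: contraNneq => ->; rewrite dot0l. Qed.

Definition enorm u : R := Num.sqrt (dot u u).

Lemma enorm_ge0 u : 0 <= enorm u. Proof. exact: sqrtr_ge0. Qed.

Lemma enorm_sq u : enorm u ^+ 2 = dot u u.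
Proof. by rewrite sqr_sqrtr // dotxx_ge0. Qed.

Lemma enorm_gt0 u : (0 < enorm u) = (u != 0).
Proof. by rewrite sqrtr_gt0 dotxx_gt0. Qed.

Lemma enormZ a u : enorm (a *: u) = `|a| * enorm u.
Proof. by rewrite /enorm dotZl dotZr mulrA -expr2 sqrtrM ?sqr_ge0 // sqrtr_sqr. Qed.

Lemma enormN u : enorm (- u) = enorm u.
Proof. by rewrite -scaleN1r enormZ normrN1 mul1r. Qed.

Lemma enormB u v : enorm (u - v) = enorm (v - u).
Proof. by rewrite -opprB enormN. Qed.

Lemma enorm1 u : dot u u = 1 -> enorm u = 1.
Proof. by rewrite /enorm => ->; rewrite sqrtr1. Qed.

Lemma enorm_unit {u} : enorm u = 1 -> dot u u = 1.
Proof. by rewrite -enorm_sq => ->; rewrite expr1n. Qed.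

Lemma cauchy_schwarz u v : `|dot u v| <= enorm u * enorm v.
Proof.
rewrite -sqrtrM ?dotxx_ge0 // -sqrtr_sqr ler_wsqrtr //.
have [->|v0] := eqVneq v 0; first by rewrite !dot0r expr0n mulr0.
have vv : 0 < dot v v by rewrite dotxx_gt0.
have := dotxx_ge0 (dot v v *: u - dot u v *: v).
rewrite !dotL (dotC v u) => h.
have : 0 <= dot v v * (dot u u * dot v v - dot u v ^+ 2) by nra.
by rewrite pmulr_rge0 // subr_ge0.
Qed.

Lemma enormD u v : enorm (u + v) <= enorm u + enorm v.
Proof.
have := cauchy_schwarz u v; have := enorm_sq (u + v).
rewrite !dotL (dotC v u) -!enorm_sq => e /ler_normlW h.
have := enorm_ge0 u; have := enorm_ge0 v; have := enorm_ge0 (u + v); nra.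
Qed.

Lemma dot_le_enorm u v : dot u v <= enorm u * enorm v.
Proof. exact/ler_normlW/cauchy_schwarz. Qed.

Definition unitv u := (enorm u)^-1 *: u.

Lemma dot_unitv u : u != 0 -> dot (unitv u) (unitv u) = 1.
Proof.
rewrite -enorm_gt0 => u0; rewrite /unitv !dotL -enorm_sq.
by field; rewrite gt_eqF.
Qed.

Definition cross u v : 'rV[R]_3 :=
  \row_(i < 3) nth 0 [:: u 0 1 * v 0 2%:R - u 0 2%:R * v 0 1;
                         u 0 2%:R * v 0 0 - u 0 0 * v 0 2%:R;
                         u 0 0 * v 0 1 - u 0 1 * v 0 0] i.

Lemma dot3E u v : dot u v = u 0 0 * v 0 0 + u 0 1 * v 0 1 + u 0 2%:R * v 0 2%:R.
Proof.
rewrite dotE !big_ord_recl big_ord0 addr0 addrA.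
by congr (_ + _ * _ + _ * _); congr (_ 0 _); apply/val_inj.
Qed.

Lemma crossE u v : ((cross u v 0 0 = u 0 1 * v 0 2%:R - u 0 2%:R * v 0 1) *
  (cross u v 0 1 = u 0 2%:R * v 0 0 - u 0 0 * v 0 2%:R) *
  (cross u v 0 2%:R = u 0 0 * v 0 1 - u 0 1 * v 0 0))%type.
Proof. by rewrite !mxE. Qed.

Lemma dot_crossl u v : dot u (cross u v) = 0.
Proof. rewrite dot3E !crossE; ring. Qed.

Lemma dot_crossr u v : dot v (cross u v) = 0.
Proof. rewrite dot3E !crossE; ring. Qed.

Lemma lagrange u v : dot (cross u v) (cross u v) = dot u u * dot v v - dot u v ^+ 2.
Proof. rewrite !dot3E !crossE; ring. Qed.

Definition ortho3 p q s :=
  [/\ dot p p = 1, dot q q = 1, dot s s = 1 & [/\ dot p q = 0, dot p s = 0 & dot q s = 0]].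

Lemma ortho3_exp p q s x : ortho3 p q s ->
  x = dot x p *: p + dot x q *: q + dot x s *: s.
Proof.
move=> [pp qq ss [pq ps qs]].
pose A : 'M[R]_3 := \matrix_(i < 3) nth 0 [:: p; q; s] i.
have AA : A *m A^T = 1%:M.
  have e i j : (A *m A^T) i j = dot (nth 0 [:: p; q; s] i) (nth 0 [:: p; q; s] j).
    by rewrite mxE dotE; apply: eq_bigr => k _; rewrite !mxE.
  apply/matrixP => i j; rewrite e !mxE.
  case: i => [[|[|[|//]]] hi]; case: j => [[|[|[|//]]] hj] //=;
    by rewrite // dotC.
have := mulmx1C AA => /(congr1 (mulmx x)); rewrite mulmx1 mulmxA => {1}<-.
apply/rowP => k; rewrite mxE !big_ord_recl big_ord0 addr0.
rewrite !mxE /= addrA.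
have e (i : 'I_3) : \sum_j x 0 j * A^T j i = dot x (nth 0 [:: p; q; s] i).
  by rewrite dotE; apply: eq_bigr => j _; rewrite !mxE.
by rewrite !e.
Qed.

Lemma ortho3_dot p q s x y : ortho3 p q s ->
  dot x y = dot x p * dot y p + dot x q * dot y q + dot x s * dot y s.
Proof.
move=> o; rewrite {1}(ortho3_exp p q s x o) !dotL.
by rewrite !(dotC _ y).
Qed.

Lemma ortho3_cross p s : dot p p = 1 -> dot s s = 1 -> dot p s = 0 ->
  ortho3 p (cross p s) s.
Proof.
move=> pp ss ps; split=> //; first by rewrite lagrange pp ss ps; ring.
by split=> //; rewrite ?dot_crossl // dotC dot_crossr.
Qed.

Lemma ortho3_coord p q s x : ortho3 p q s -> dot x p = 0 -> dot x q = 0 -> 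
  dot x s = 0 -> x = 0.
Proof. by move=> /ortho3_exp -/(_ x) e h1 h2 h3; rewrite e h1 h2 h3 !scale0r !addr0. Qed.

Lemma ortho3_extend p : dot p p = 1 -> exists q s, ortho3 p q s.
Proof.
move=> pp; suff [q qq pq] : exists2 q, q != 0 & dot p q = 0.
  have h := ortho3_cross p (unitv q) pp (dot_unitv q qq).
  exists (cross p (unitv q)), (unitv q); apply: h.
  by rewrite dotZr pq mulr0.
have [/eqP p0|p0] := boolP (p 0 0 == 0).
  exists (delta_mx 0 0).
    by apply/eqP => /rowP/(_ 0); rewrite !mxE /= => /eqP; rewrite oner_eq0.
  by rewrite dot3E p0 !mxE /= !mulr0 mul0r !addr0.
exists (p 0 1 *: delta_mx 0 0 - p 0 0 *: delta_mx 0 1).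
  apply/eqP => /rowP/(_ 1); rewrite !mxE /= mulr0 mulr1 sub0r => /eqP.
  by rewrite oppr_eq0 (negPf p0).
rewrite dot3E !mxE /=; ring.
Qed.

Lemma enormBB u v : `|enorm u - enorm v| <= enorm (u - v).
Proof.
have h x y : enorm x - enorm y <= enorm (x - y).
  by rewrite lerBlDr; apply: le_trans (enormD _ _); rewrite subrK.
rewrite ler_norml h andbT lerNl opprB enormB; exact: h.
Qed.

Lemma enorm_unitv u : u != 0 -> enorm (unitv u) = 1.
Proof. by move=> u0; apply/enorm1/dot_unitv. Qed.

Lemma unitvK u : u != 0 -> enorm u *: unitv u = u.
Proof. by rewrite -enorm_gt0 => u0; rewrite /unitv scalerA divff ?scale1r // gt_eqF. Qed.

Lemma unitv_dist u : u != 0 -> enorm (unitv u - u) = `|1 - enorm u|.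
Proof.
move=> u0; rewrite -{2}(unitvK u u0) -{1}[unitv u]scale1r -scalerBl enormZ.
by rewrite enorm_unitv // mulr1.
Qed.

Lemma enorm_dist u v w : enorm (u - w) <= enorm (u - v) + enorm (v - w).
Proof. by apply: le_trans (enormD _ _); rewrite addrA subrK. Qed.

Lemma bessel2 q s y : dot q q = 1 -> dot s s = 1 -> dot q s = 0 ->
  dot y q ^+ 2 + dot y s ^+ 2 <= enorm y ^+ 2.
Proof.
move=> qq ss qs; have := dotxx_ge0 (y - dot y q *: q - dot y s *: s).
rewrite enorm_sq !dotL qq ss (dotC s q) qs (dotC q y) (dotC s y); lra.
Qed.

(** Here [a] and [b] are the coordinates along [q] and [s] of a vector of norm [m]. A vector almost
    parallel to [s] has slope at most [eta / 2], because (1 + eta^2/4)(1 - eta^2/16)^2 > 1 for these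
    [eta]. *)
Lemma cone_gap (eta a b m : R) : 0 < eta -> eta <= 1 / 8 -> 0 <= a -> 0 <= b -> 0 <= m ->
  eta / 2 * b < a -> (1 - eta ^+ 2 / 16) * m <= b -> a ^+ 2 + b ^+ 2 <= m ^+ 2 -> False.
Proof.
move=> eta0 etae a0 b0 m0 ha hb h.
have q1 : eta ^+ 2 <= (1 / 8) ^+ 2 by rewrite ler_pXn2r // ?nnegrE; lra.
have q0 : 0 < eta ^+ 2 by rewrite exprn_gt0.
have l2 : (1 - eta ^+ 2 / 16) ^+ 2 * m ^+ 2 <= b ^+ 2.
  by rewrite -exprMn ler_pXn2r // nnegrE mulr_ge0 //; lra.
have a2 : eta ^+ 2 / 4 * b ^+ 2 < a ^+ 2.
  have -> : eta ^+ 2 / 4 * b ^+ 2 = (eta / 2 * b) ^+ 2 by field.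
  by rewrite ltr_pXn2r // nnegrE mulr_ge0 //; lra.
move: h q1 q0 l2 a2 (sqr_ge0 b) (sqr_ge0 m); clear.
move: (a ^+ 2) (b ^+ 2) (m ^+ 2) (eta ^+ 2) => A B M f h q1 q0 l2 a2 B0 M0.
have l3 : (1 - f / 8) * M <= B by nra.
nra.
Qed.

Lemma ortho3_turn p q s a : ortho3 p q s ->
  let n := Num.sqrt (1 + a ^+ 2) in
  ortho3 (n^-1 *: (p + a *: q)) (n^-1 *: (q - a *: p)) s.
Proof.
move=> [pp qq ss [pq ps qs]] n.
have nn : n ^+ 2 = 1 + a ^+ 2 by rewrite sqr_sqrtr // addr_ge0 // sqr_ge0.
have n0 : n != 0 by rewrite -(sqrf_eq0 n) nn gt_eqF // ltr_wpDr // sqr_ge0.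
have e : n^-1 * n^-1 * (1 + a ^+ 2) = 1 by rewrite -nn; field.
split=> //; rewrite ?dotL ?(dotC q p) ?(dotC s) ?pp ?qq ?pq ?ps ?qs; try by rewrite -{3}e; ring.
by split; ring.
Qed.

Lemma enorm_turn e f n (a : R) : ortho3 e f n -> enorm (e + a *: f) = Num.sqrt (1 + a ^+ 2).
Proof.
move=> [ee ff _ [ef _ _]]; rewrite /enorm !dotL ee ff ef (dotC f) ef.
by congr Num.sqrt; ring.
Qed.

Lemma unitv_lip u v : u != 0 -> 1 <= enorm v -> enorm (unitv u - unitv v) <= 2 * enorm (u - v).
Proof.
move=> u0 v1; have v0 : v != 0 by rewrite -enorm_gt0; lra.
have nv : 0 < enorm v by rewrite enorm_gt0.
have e : unitv u - unitv v = (enorm v)^-1 *: (u - v) + ((enorm v - enorm u) / enorm v) *: unitv u.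
  rewrite scalerBr -/(unitv v) [RHS]addrAC; congr (_ - _).
  rewrite mulrBl divff ?gt_eqF // scalerBl scale1r mulrC -scalerA unitvK //.
  by rewrite addrC subrK.
have i1 : (enorm v)^-1 <= 1 by rewrite invf_le1.
rewrite e; apply: le_trans (enormD _ _) _; rewrite (enormZ _ (u - v)) (enormZ _ (unitv u)) (enorm_unitv _ u0) mulr1.
rewrite normrM !normfV (gtr0_norm nv).
have := enormBB v u; rewrite enormB => h.
have n0 := enorm_ge0 (u - v).
have : (enorm v)^-1 * enorm (u - v) <= enorm (u - v) by rewrite ler_piMl.
have : `|enorm v - enorm u| / enorm v <= enorm (u - v).
  by apply: le_trans h; rewrite ler_piMr.
lra.
Qed.

Lemma dot_close u v : dot v v = 1 -> enorm (u - v) < 1 / 2 -> 1 / 2 < dot v u.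
Proof.
move=> vv h; have := cauchy_schwarz v (u - v); rewrite (enorm1 _ vv) mul1r dotDr dotNr vv.
rewrite ler_norml => /andP[h' _]; lra.
Qed.

Lemma nbhs_enorm u eta : 0 < eta -> nbhs u [set w | enorm (w - u) < eta].
Proof.
(* A sup-norm ball of radius [eta / 2] in dimension 3 has squared Euclidean radius at most 3
   eta^2/4. *)
move=> e0; apply/nbhs_ballP; exists (eta / 2) => /=; first by rewrite divr_gt0.
move=> w /= [_ uw]; rewrite -(ltr_pXn2r (n := 2)) ?nnegrE ?enorm_ge0 ?ltW // enorm_sq dot3E.
have h i : (w - u) 0 i * (w - u) 0 i <= (eta / 2) ^+ 2.
  have := uw 0 i; rewrite /ball /= !mxE => h.
  rewrite -expr2 -(real_normK (num_real _)) ler_pXn2r ?nnegrE // ?divr_ge0 ?ltW //.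
  by rewrite distrC.
have := h 0; have := h 1; have := h 2%:R.
have -> : (eta / 2) ^+ 2 = eta ^+ 2 / 4 by field.
have : 0 < eta ^+ 2 by rewrite exprn_gt0.
lra.
Qed.

(** * Limits of unit vectors *)

Lemma small_eq0 (a : R) : (forall eta, 0 < eta -> `|a| < eta) -> a = 0.
Proof.
move=> h; apply/eqP/negPn/negP => a0; have := h `|a|.
by rewrite ltxx normr_gt0 => /(_ a0).
Qed.

(** Compactness of the cube gives [r], but the label may still vary with the scale. If every label
    failed at some scale, the least of these scales would be contradicted, since monotonicity of [Q]
    carries success there to the scale of the label found. *)
Lemma cluster_unit (F : finType) (Q : R -> 'rV[R]_3 -> F -> Prop) :
  (forall eta eta' u k, eta <= eta' -> Q eta u k -> Q eta' u k) ->
  (forall eta, 0 < eta -> exists u k, dot u u = 1 /\ Q eta u k) ->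
  exists r k, dot r r = 1 /\
    forall eta, 0 < eta -> exists u, [/\ dot u u = 1, enorm (u - r) < eta & Q eta u k].
Proof.
move=> Qmon Qex.
have /choice[u hu] : forall n : nat, exists u, exists k, dot u u = 1 /\ Q (n.+1%:R^-1) u k.
  by move=> n; apply: Qex; rewrite invr_gt0.
pose K := [set v : 'rV[R]_3 | forall i, `[-1, 1]%classic (v ord0 i)].
have cK : compact K.
  have h := @rV_compact R 3 (fun=> `[-1, 1]%classic) (fun _ => @segment_compact R _ _).
  exact: h.
have uK : (u @ \oo) K.
  exists 0%N => // n _ i /=; rewrite in_itv /= -ler_norml.
  have [k [h _]] := hu n.
  rewrite -(ler_pXn2r (n := 2)) ?nnegrE // expr1n (real_normK (num_real _)) -h dotE.
  by rewrite expr2 (bigD1 i) //= lerDl sumr_ge0 // => j _; rewrite -expr2 sqr_ge0.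
have [r [_ rcl]] := cK _ _ uK.
have near eta : 0 < eta -> exists w k, [/\ dot w w = 1, enorm (w - r) < eta & Q eta w k].
  move=> e0; pose N := (Num.truncn eta^-1).+1.
  have hN : (u @ \oo) [set u n | n in [set n | (N <= n)%N]] by exists N => // n /= hn; exists n.
  have [w [[n /= hn <-] hw]] := rcl _ _ hN (nbhs_enorm r _ e0).
  have [k [h1 h2]] := hu n; exists (u n), k; split=> //.
  apply: Qmon h2; rewrite -[leRHS]invrK lef_pV2 ?posrE ?invr_gt0 //.
  apply: le_trans (ltW (truncnS_gt _)) _; rewrite ler_nat; exact: leqW.
have rr : dot r r = 1.
  apply/enorm_unit/eqP; rewrite -subr_eq0; apply/eqP/small_eq0 => eta /near[w [k [ww h _]]].
  by apply: le_lt_trans h; rewrite -(enorm1 _ ww) enormB; exact: enormBB.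
exists r.
have [k hk] : exists k, forall eta, 0 < eta ->
    exists w, [/\ dot w w = 1, enorm (w - r) < eta & Q eta w k]; last by exists k.
apply/not_existsP => H.
have /choice[e he] : forall k, exists eta, 0 < eta /\
    ~ exists w, [/\ dot w w = 1, enorm (w - r) < eta & Q eta w k].
  by move=> k; have /existsNP[eta /not_implyP[h1 h2]] := H k; exists eta.
pose m := \big[Num.min/1]_k e k.
have m0 : 0 < m by rewrite /m; elim/big_rec: _ => // k x _ x0; rewrite lt_min x0 (he k).1.
have [w [k [ww hw qw]]] := near _ m0.
have mk : m <= e k by rewrite /m (bigD1 k) //= ge_min lexx.
apply: (he k).2; exists w; split=> //; first exact: lt_le_trans mk.
exact: Qmon mk qw.
Qed.

(** Two uses of the case of one vector: [w] is first hidden under an existential, with a dummy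
    label, and then clustered while [u] stays close to the limit already found. *)
Lemma cluster_unit2 (F : finType) (Q : R -> 'rV[R]_3 -> 'rV[R]_3 -> F -> Prop) :
  (forall eta eta' u w k, eta <= eta' -> Q eta u w k -> Q eta' u w k) ->
  (forall eta, 0 < eta -> exists u w k, [/\ dot u u = 1, dot w w = 1 & Q eta u w k]) ->
  exists r t k, [/\ dot r r = 1, dot t t = 1 &
    forall eta, 0 < eta -> exists u w,
     [/\ dot u u = 1, dot w w = 1, enorm (u - r) < eta, enorm (w - t) < eta & Q eta u w k]].
Proof.
move=> Qmon Qex.
pose Q1 eta u (k : unit) := exists w k, dot w w = 1 /\ Q eta u w k.
have [eta eta' u k ee [w [k' [ww h]]]|eta e0|r [k0 [rr hr]]] := cluster_unit _ Q1.
- by exists w, k'; split=> //; exact: Qmon ee h.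
- by have [u [w [k [uu ww h]]]] := Qex _ e0; exists u, tt; split=> //; exists w, k.
pose Q2 eta w k := exists u, [/\ dot u u = 1, enorm (u - r) < eta & Q eta u w k].
have [eta eta' w k ee [u [uu h h']]|eta e0|t [k [tt' ht]]] := cluster_unit _ Q2.
- by exists u; split=> //; [exact: lt_le_trans ee|exact: Qmon ee h'].
- have [u [uu h1 [w [k [ww h2]]]]] := hr _ e0.
  by exists w, k; split=> //; exists u.
exists r, t, k; split=> // eta e0; have [w [ww h1 [u [uu h2 h3]]]] := ht _ e0.
by exists u, w.
Qed.

(* Moving one factor at a time reduces a sign change of a bilinear form to a linear equation. *)
Lemma bilinear_root (x0 x1 y0 y1 : 'rV[R]_3) : 0 < dot x0 y0 -> dot x1 y1 < 0 ->
  exists a b : R, [/\ 0 <= a <= 1, 0 <= b <= 1 &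
    dot ((1 - a) *: x0 + a *: x1) ((1 - b) *: y0 + b *: y1) = 0].
Proof.
have lin (f0 f1 : R) : 0 < f0 -> f1 <= 0 -> exists2 a, 0 <= a <= 1 & (1 - a) * f0 + a * f1 = 0.
  move=> h0 h1; have h : 0 < f0 - f1 by lra.
  exists (f0 / (f0 - f1)); last by field; rewrite gt_eqF.
  by rewrite divr_ge0 ?ler_pdivrMr ?mul1r //; lra.
move=> h0 h1; have [h|h] := leP (dot x1 y0) 0.
  have [a ha e] := lin _ _ h0 h; exists a, 0; split=> //; first by rewrite lexx ler01.
  by rewrite !dotL; move: e; lra.
have [b hb e] := lin _ _ h (ltW h1); exists 1, b; split=> //; first by rewrite lexx ler01.
by rewrite !dotL; move: e; lra.
Qed.

Lemma dot_near (x y : 'rV[R]_3) : 0 < dot x y -> exists2 eta, 0 < eta &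
  forall x' y', enorm (x' - x) < eta -> enorm (y' - y) < eta -> 0 < dot x' y'.
Proof.
move=> h; pose M := enorm x + enorm y + 1.
have nx := enorm_ge0 x; have ny := enorm_ge0 y.
have M1 : 1 <= M by rewrite /M; lra.
pose eta := Num.min 1 (dot x y / (2 * M)).
have e0 : 0 < eta by rewrite lt_min ltr01 divr_gt0 //; lra.
have e1 : eta <= 1 by rewrite ge_min lexx.
have e2 : eta * (2 * M) <= dot x y by rewrite -ler_pdivlMr ?ge_min ?lexx ?orbT //; lra.
exists eta => // x' y' hx hy.
have -> : dot x' y' = dot x y + dot (x' - x) (y' - y) + dot (x' - x) y + dot x (y' - y).
  by rewrite !dotL; ring.
have c1 := cauchy_schwarz (x' - x) (y' - y).
have c2 := cauchy_schwarz (x' - x) y; have c3 := cauchy_schwarz x (y' - y).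
move: c1 c2 c3; rewrite !ler_norml => /andP[c1 _] /andP[c2 _] /andP[c3 _].
have := enorm_ge0 (x' - x); have := enorm_ge0 (y' - y) => n1 n2.
have : enorm (x' - x) * enorm (y' - y) <= eta * 1 by apply: ler_pM; lra.
have : enorm (x' - x) * enorm y <= eta * enorm y by apply: ler_wpM2r; lra.
have : enorm x * enorm (y' - y) <= eta * enorm x by rewrite mulrC; apply: ler_wpM2r; lra.
rewrite /M in e2; have : enorm (x' - x) * enorm y < eta * (enorm y + 1) by nra.
nra.
Qed.

Lemma nbhs_enormP u (A : set 'rV[R]_3) : nbhs u A ->
  exists2 eta, 0 < eta & forall w, enorm (w - u) < eta -> A w.
Proof.
move=> /nbhs_ballP[e /= e0 h]; exists e => // w hw; apply: h.
split=> // i j; rewrite ord1 /ball /=.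
rewrite distrC; apply: le_lt_trans hw.
rewrite -(ler_pXn2r (n := 2)) ?nnegrE ?enorm_ge0 // real_normK ?num_real // enorm_sq dotE.
rewrite (bigD1 j) //= !mxE -expr2 lerDl sumr_ge0 // => k _.
by rewrite -expr2 sqr_ge0.
Qed.

End Vectors.

(** * Four colors and Bernoulli's inequality *)

Lemma ord4_others (l k : 'I_4) : l != k ->
  exists i j : 'I_4, [/\ i != j, [/\ i != l, i != k, j != l & j != k] &
    forall m, [|| m == l, m == k, m == i | m == j]].
Proof.
move=> lk; have : #|~: [set l; k]| == 2.
  by rewrite cardsCs finset.setCK cards2 lk card_ord.
move=> /cards2P[i [j [ij e]]].
have im : i \in ~: [set l; k] by rewrite e !inE eqxx.
have jm : j \in ~: [set l; k] by rewrite e !inE eqxx orbT.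
exists i, j; move: im jm; rewrite !inE !negb_or => /andP[-> ->] /andP[-> ->].
split=> // m; have := congr1 (fun A : {set 'I_4} => m \in A) e.
by rewrite !inE; case: (m == l); case: (m == k) => //= <-.
Qed.

Lemma bernoulli (R : realType) (x : R) n : 0 <= x -> 1 + n%:R * x <= (1 + x) ^+ n.
Proof.
move=> x0; elim: n => [|n IH]; first by rewrite mul0r addr0.
rewrite exprS; have n0 : 0 <= n%:R :> R by exact: ler0n.
rewrite -natr1; apply: le_trans (_ : (1 + x) * (1 + n%:R * x) <= _); first nra.
by rewrite ler_wpM2l // addr_ge0.
Qed.

Lemma not_inj4 (f : 'I_4 -> 'I_4) (m : 'I_4) : (forall a, f a != m) ->
  exists a b, a != b /\ f a = f b.
Proof.
move=> h; have /injectivePn[a [b ab e]] : ~~ injectiveb f.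
  apply/negP => /injectiveP fi; have [g _ gK] := injF_bij fi.
  by have := h (g m); rewrite gK eqxx.
by exists a, b.
Qed.

(** * Colorings of lines in which every color avoids an open set of lines *)
Section Coloring.
Context {R : realType} (c : 'I_4 -> 'rV[R]_3 -> Prop).
Implicit Types (p q s x y z : 'rV[R]_3).
Hypothesis cE : forall x, x != 0 -> exists i, c i x.
Hypothesis cZ : forall i (a : R) x, a != 0 -> c i x -> c i (a *: x).
Hypothesis cO : forall i x y, c i x -> c i y -> dot x y != 0.
Context (d : 'I_4 -> 'rV[R]_3) (eps : R).
Hypothesis eps0 : 0 < eps.
Hypothesis eps1 : eps <= 1.
Hypothesis d1 : forall i, dot (d i) (d i) = 1.
Hypothesis dP : forall i x, c i x -> eps * enorm x <= `|dot (d i) x|.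

(** Keeps a coefficient away from zero at a controlled cost, so that the quotient of two such
    coefficients is bounded in both directions. *)
Lemma perturb (a e : R) : 0 < e -> `|a| <= 1 -> exists b, `|b| = e /\ e <= `|a + b| <= 1 + e.
Proof.
move=> e0 a1; have [a0|a0] := leP 0 a.
  exists e; rewrite (ger0_norm (ltW e0)) (@ger0_norm _ (a + e)); last lra.
  by move: a1; rewrite ger0_norm // => a1; split=> //; apply/andP; split; lra.
exists (- e); rewrite normrN (ger0_norm (ltW e0)) ltr0_norm; last lra.
by move: a1; rewrite ltr0_norm // => a1; split=> //; lra.
Qed.

(** Color [i] is absent near the zero of the affine function [a -> dot (d i) (q + a *: s)]. That
    zero may be 0 or infinite; moving both coefficients by [eps / 4] brings it into a fixed range,
    and the slack left in [dP] still excludes the color. *)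
Lemma window i q s : dot q q = 1 -> dot s s = 1 -> dot q s = 0 ->
  exists a0, [/\ eps / 8 <= `|a0|, `|a0| <= 8 / eps &
    forall a, `|a - a0| < eps / 4 -> ~ c i (q + a *: s)].
Proof.
move=> qq ss qs; have e0 := eps0; have e1 := eps1.
have bnd x : dot x x = 1 -> `|dot (d i) x| <= 1.
  by move=> /enorm1 x1; apply: le_trans (cauchy_schwarz _ _) _; rewrite x1 (enorm1 _ (d1 i)) mulr1.
have e4 : 0 < eps / 4 by lra.
have [al [al1 /andP[A1 A2]]] := perturb _ _ e4 (bnd _ qq).
have [be [be1 /andP[B1 B2]]] := perturb _ _ e4 (bnd _ ss).
set A := dot _ q + al in A1 A2; set B := dot _ s + be in B1 B2.
have B0 : B != 0 by rewrite -normr_gt0; lra.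
have nB : 0 < `|B| by rewrite normr_gt0.
exists (- A / B); rewrite normrM normrN normfV; split.
- rewrite ler_pdivlMr //; nra.
- rewrite ler_pdivrMr // mulrAC ler_pdivlMr //; nra.
move=> a wa ca; have := dP _ _ ca.
set x := q + a *: s.
have xx : dot x x = 1 + a ^+ 2 by rewrite !dotL qq ss qs (dotC s) qs; ring.
have e : A + a * B = dot (d i) x + (al + a * be) by rewrite /A /B !dotL; ring.
have h1 : `|A + a * B| < eps / 2.
  have -> : A + a * B = B * (a - - A / B) by field.
  rewrite normrM; have w0 := normr_ge0 (a - - A / B).
  have B3 : `|B| <= 2 by lra.
  apply: le_lt_trans (ler_wpM2r w0 B3) _; move: wa w0; set W := `|_|; lra.
have h2 : `|al + a * be| <= eps / 4 * (1 + `|a|).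
  apply: le_trans (ler_normD _ _) _; by rewrite normrM al1 be1 mulrDr mulr1 (mulrC `|a|).
have h3 : `|dot (d i) x| <= `|A + a * B| + `|al + a * be|.
  have -> : dot (d i) x = (A + a * B) - (al + a * be) by rewrite e; ring.
  exact: ler_normB.
have xs := enorm_sq x; rewrite xx -(real_normK (num_real a)) in xs.
have := enorm_ge0 x; have := normr_ge0 a => na nx.
have X1 : 1 + `|a| <= 2 * enorm x.
  rewrite -ler_sqr ?nnegrE; [|lra|lra].
  have := sqr_ge0 (1 - `|a|); rewrite exprMn xs; nra.
have X2 : 1 <= enorm x.
  by rewrite -ler_sqr ?nnegrE // xs expr1n lerDl sqr_ge0.
have X3 : eps / 4 * (1 + `|a|) <= eps / 2 * enorm x.
  by apply: le_trans (ler_wpM2l (ltW e4) X1) _; rewrite mulrA; lra.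
have X4 : eps / 2 <= eps / 2 * enorm x by rewrite ler_peMr //; lra.
lra.
Qed.

(** * Two planes on which only two colors remain *)

Section Core.
Context (l k i j : 'I_4) (p q s : 'rV[R]_3) (t xi : R).
Hypothesis o : ortho3 p q s.
Hypothesis cover4 : forall m, [|| m == l, m == k, m == i | m == j].
Hypothesis kp : c k p.
Hypothesis kp' : c k (p + t *: q).
Hypothesis gap : forall y, dot y p = 0 \/ dot y (p + t *: q) = 0 ->
  xi * `|dot y s| < `|dot y q| -> ~ c l y.
Hypothesis xi0 : 0 < xi.

Let dots : (dot p p = 1) * (dot q q = 1) * (dot s s = 1) * (dot p q = 0) * (dot q p = 0) *
  (dot p s = 0) * (dot s p = 0) * (dot q s = 0) * (dot s q = 0).
Proof. by case: o => pp qq ss [pq ps qs]; rewrite pp qq ss (dotC q p) (dotC s) (dotC s q) pq ps qs. Qed.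

Lemma two_colored y : dot y p = 0 \/ dot y (p + t *: q) = 0 ->
  xi * `|dot y s| < `|dot y q| -> c i y \/ c j y.
Proof.
move=> yp ys; have y0 : y != 0.
  apply: contraTneq ys => ->; rewrite !dot0l normr0 mulr0 ltxx //.
have [m cm] := cE _ y0.
have := cover4 m => /or4P[]/eqP em; subst m.
- by have := gap _ yp ys cm.
- by case: yp => e; [have := cO _ _ _ cm kp|have := cO _ _ _ cm kp']; rewrite e eqxx.
- by left.
- by right.
Qed.

(** Orthogonality to [x] forces [w] into the other color, and orthogonality to [w] forces [z] back
    into [m]. *)
Lemma same_color m x z w : m = i \/ m = j -> c m x -> c i z \/ c j z -> c i w \/ c j w ->
  dot x w = 0 -> dot z w = 0 -> c m z.
Proof.
move=> hm cx cz cw xw zw.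
have F n u v : c n u -> c n v -> dot u v = 0 -> False.
  by move=> h1 h2 e; have := cO _ _ _ h1 h2; rewrite e eqxx.
case: hm => em; subst m; case: cz cw => cz [] cw //.
- by case: (F _ _ _ cx cw xw).
- by case: (F _ _ _ cz cw zw).
- by case: (F _ _ _ cz cw zw).
- by case: (F _ _ _ cx cw xw).
Qed.

(* With [x := q + a s], [z := x - t p] and [y := (1 + t^2) q + a s], the vector [w] is
   orthogonal to [x] and [z], and [w'] to [z] and [y]; since only two colors are
   available, [x], [z] and [y] have the same color. *)
Lemma color_step m a : m = i \/ m = j -> xi * (1 + t ^+ 2) < `|a| -> xi * `|a| < 1 ->
  c m (q + a *: s) <-> c m ((1 + t ^+ 2) *: q + a *: s).
Proof.
move=> hm a1 a2; have t2 := sqr_ge0 t; have x0 := xi0.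
set x := q + _; set y := _ + a *: s; pose z := x - t *: p.
pose w := s - a *: q; pose w' := (a * t) *: p - a *: q + (1 + t ^+ 2) *: s.
have nt : `|1 + t ^+ 2| = 1 + t ^+ 2 by rewrite ger0_norm //; lra.
have cx : c i x \/ c j x.
  apply: two_colored; first by left; rewrite /x !dotL !dots; ring.
  by rewrite /x !dotL !dots !(mulr0, mulr1, addr0, add0r, normr1).
have cz : c i z \/ c j z.
  apply: two_colored; first by right; rewrite /z /x !dotL !dots; ring.
  by rewrite /z /x !dotL !dots !(mulr0, mulr1, addr0, add0r, subr0, oppr0, normr1).
have cy : c i y \/ c j y.
  apply: two_colored; first by left; rewrite /y !dotL !dots; ring.
  rewrite /y !dotL !dots !(mulr0, mulr1, addr0, add0r, subr0, normr1) nt; nra.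
have cw : c i w \/ c j w.
  apply: two_colored; first by left; rewrite /w !dotL !dots; ring.
  rewrite /w !dotL !dots !(mulr0, mulr1, addr0, add0r, subr0, sub0r, oppr0, normrN, normr1); nra.
have cw' : c i w' \/ c j w'.
  apply: two_colored; first by right; rewrite /w' !dotL !dots; ring.
  by rewrite /w' !dotL !dots !(mulr0, mulr1, addr0, add0r, subr0, sub0r, oppr0, normrN, normr1) nt.
have xw : dot x w = 0 by rewrite /x /w !dotL !dots; ring.
have zw : dot z w = 0 by rewrite /z /x /w !dotL !dots; ring.
have zw' : dot z w' = 0 by rewrite /z /x /w' !dotL !dots; ring.
have yw' : dot y w' = 0 by rewrite /y /w' !dotL !dots; ring.
split=> cm.
- exact: (same_color m z y w' hm (same_color m x z w hm cm cz cw xw zw) cy cw' zw' yw').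
- exact: (same_color m z x w hm (same_color m y z w' hm cm cz cw' yw' zw') cx cw zw xw).
Qed.

Lemma color_step_down m a : m = i \/ m = j -> xi * (1 + t ^+ 2) < `|a| -> xi * `|a| < 1 ->
  c m (q + a *: s) -> c m (q + (a / (1 + t ^+ 2)) *: s).
Proof.
move=> hm a1 a2 /(color_step m a hm a1 a2) /(cZ _ (1 + t ^+ 2)^-1).
have g0 : 1 + t ^+ 2 != 0 by rewrite gt_eqF //; have := sqr_ge0 t; lra.
rewrite scalerDr !scalerA mulVf // scale1r mulrC; apply.
by rewrite invr_eq0.
Qed.

Lemma color_step_up m a : m = i \/ m = j ->
  xi * (1 + t ^+ 2) < `|a * (1 + t ^+ 2)| -> xi * `|a * (1 + t ^+ 2)| < 1 ->
  c m (q + a *: s) -> c m (q + (a * (1 + t ^+ 2)) *: s).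
Proof.
move=> hm a1 a2 ca; apply/(color_step m _ hm a1 a2).
rewrite mulrC -scalerA -scalerDr; apply: cZ => //.
by rewrite gt_eqF //; have := sqr_ge0 t; lra.
Qed.

Section Side.
Context (a0 eta nu : R).
Hypothesis t0 : t != 0.
Hypothesis eta0 : 0 < eta.
Hypothesis xi_eta : xi * 2 <= eta.
Hypothesis t1 : t ^+ 2 <= 1.
Hypothesis a0l : eta <= a0.
Hypothesis a0r : a0 * eta <= 1.
Hypothesis a0t : a0 * t ^+ 2 < nu.
Hypothesis win : forall a, `|a - a0| < nu -> ~ c i (q + a *: s).

Let g := 1 + t ^+ 2.

Let g1 : 1 < g. Proof. by rewrite /g ltrDl lt0r sqr_ge0 sqrf_eq0 t0. Qed.

(** Dividing by [g] moves [a] towards [a0]. Above the window, [a >= a0 + nu > a0 * g] by [a0t], so a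
    step never passes below [a0] and cannot jump over the window; [n] bounds the number of steps. *)
Lemma side_above n a : a0 <= a -> a <= a0 * g ^+ n -> a * eta < 1 -> ~ c i (q + a *: s).
Proof.
have e0 := eta0; have x0 := xi0; have xe := xi_eta; have hh1 := t1; have hh2 := a0l; have hh3 := a0r; have hh4 := a0t; have hh5 := g1.
elim: n a => [|n IH] a aa an ae ca.
  apply: (win a) => //; have -> : a = a0 by move: an; rewrite expr0 mulr1; lra.
  by rewrite subrr normr0; have := sqr_ge0 t; nra.
have [w|w] := ltP `|a - a0| nu; first exact: win w ca.
have aw : a0 + nu <= a by move: w; rewrite ger0_norm; lra.
have ag : a0 * g <= a by rewrite /g; lra.
have na : `|a| = a by rewrite ger0_norm //; lra.
have gg : 0 < g by lra.
apply: (IH (a / g)).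
- by rewrite ler_pdivlMr.
- by rewrite ler_pdivrMr // -mulrA -exprSr.
- have : a / g <= a by rewrite ler_pdivrMr // ler_peMr; lra.
  by move=> h; apply: le_lt_trans ae; rewrite ler_wpM2r // ltW.
- apply: color_step_down => //; first by left.
    by rewrite na; apply: le_lt_trans (_ : xi * 2 < _); [nra|nra].
  rewrite na; nra.
Qed.

Lemma side_below n a : a <= a0 -> a0 <= a * g ^+ n -> eta < a -> ~ c i (q + a *: s).
Proof.
have e0 := eta0; have x0 := xi0; have xe := xi_eta; have hh1 := t1; have hh2 := a0l; have hh3 := a0r; have hh4 := a0t; have hh5 := g1.
elim: n a => [|n IH] a aa an ae ca.
  apply: (win a) => //; have -> : a = a0 by move: an; rewrite expr0 mulr1; lra.
  by rewrite subrr normr0; have := sqr_ge0 t; nra.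
have [w|w] := ltP `|a - a0| nu; first exact: win w ca.
have aw : a <= a0 - nu by move: w; rewrite ler0_norm; lra.
have gg : 0 < g by lra.
have t2 := sqr_ge0 t.
have ag : a * g <= a0 by rewrite /g; nra.
have aga : a <= a * g by rewrite ler_peMr; lra.
have na : `|a * (1 + t ^+ 2)| = a * g by rewrite ger0_norm //; rewrite -/g; lra.
apply: (IH (a * g)) => //.
- by rewrite -mulrA -exprS.
- lra.
- apply: color_step_up => //; first by left.
    rewrite na -/g ltr_pM2r //; lra.
  rewrite na; nra.
Qed.

Lemma side a : eta < a -> a * eta < 1 -> ~ c i (q + a *: s).
Proof.
move=> ae ea; have e0 := eta0; have x0 := xi0; have xe := xi_eta; have hh1 := t1; have hh2 := a0l; have hh3 := a0r; have hh4 := a0t; have hh5 := g1.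
have t2 : 0 < t ^+ 2 by rewrite lt0r sqr_ge0 sqrf_eq0 t0.
have unb b : exists n, b <= g ^+ n.
  exists (Num.truncn (`|b| / t ^+ 2)).+1; apply: le_trans (bernoulli _ _ _ (ltW t2)).
  have := truncnS_gt (`|b| / t ^+ 2); rewrite ltr_pdivrMr // => h.
  have := ler_norm b; lra.
have [aa|aa] := leP a0 a.
  have [n hn] := unb (a / a0); apply: (side_above n) => //.
  by rewrite mulrC -ler_pdivrMr //; lra.
have [n hn] := unb (a0 / a); apply: (side_below n) => //; first exact: ltW.
by rewrite mulrC -ler_pdivrMr //; lra.
Qed.

(** Color [i] is excluded on the positive side, which leaves [j]. As [q - a *: s] is orthogonal to
    [q + a^-1 *: s], the negative side cannot have color [j]; this is why the range of [a] is
    symmetric under inversion. *)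
Lemma side_pattern a : eta < a -> a * eta < 1 ->
  c j (q + a *: s) /\ c i (q - a *: s).
Proof.
have e0 := eta0; have x0 := xi0; have xe := xi_eta; have hh1 := t1; have hh2 := a0l; have hh3 := a0r; have hh4 := a0t; have hh5 := g1.
have two b : eta < `|b| -> `|b| * eta < 1 -> c i (q + b *: s) \/ c j (q + b *: s).
  move=> b1 b2; apply: two_colored; first by left; rewrite !dotL !dots; ring.
  rewrite !dotL !dots !(mulr0, mulr1, addr0, add0r, normr1); nra.
have P b : eta < b -> b * eta < 1 -> c j (q + b *: s).
  move=> b1 b2; have nb : `|b| = b by rewrite ger0_norm //; lra.
  by case: (two b); rewrite ?nb // => /side; case.
move=> ae ea; have ap : 0 < a by lra.
split; first exact: P.
have := two (- a); rewrite normrN gtr0_norm // scaleNr => -[] // cj.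
have ia : a * a^-1 = 1 by rewrite divff // lt0r_neq0.
have h1 : eta < a^-1 by rewrite -(ltr_pM2l ap) ia.
have h2 : a^-1 * eta < 1 by rewrite -(ltr_pM2l ap) mulrA ia; lra.
have := cO _ _ _ cj (P _ h1 h2); rewrite (_ : dot _ _ = 0) ?eqxx //.
by rewrite !dotL !dots; field; rewrite lt0r_neq0.
Qed.
End Side.
End Core.

(** The window is taken for one of the two remaining colors; the sign of its center decides from
    which side of [q] that color is excluded, and a negative center is reduced to a positive one by
    replacing [s] with [- s]. The bound on [t^2] makes the step finer than the window:
    [8 / eps * (eps ^+ 2 / 32) = eps / 4]. *)
Lemma core l k p q s t xi eta : ortho3 p q s -> l != k -> c k p -> c k (p + t *: q) ->
  t != 0 -> t ^+ 2 < eps ^+ 2 / 32 -> 0 < xi -> xi * 2 <= eta -> eta <= eps / 8 ->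
  (forall y, dot y p = 0 \/ dot y (p + t *: q) = 0 ->
    xi * `|dot y s| < `|dot y q| -> ~ c l y) ->
  exists i j, [/\ i != j, i != l, j != l &
    forall a, eta < a -> a * eta < 1 -> c i (q + a *: s) /\ c j (q - a *: s)].
Proof.
move=> o lk kp kp' t0 t1 xi0 xie etae gap; have e0 := eps0; have e1 := eps1.
have [i [j [ij [il ik jl jk] cov]]] := ord4_others _ _ lk.
have [pp qq ss [pq ps qs]] := o.
have [a0 [w1 w2 w]] := window i q s qq ss qs.
have eta0 : 0 < eta by lra.
have b1 : `|a0| * eta <= 1.
  apply: le_trans (_ : 8 / eps * (eps / 8) <= _).
    by rewrite ler_pM // ?normr_ge0 //; lra.
  by rewrite le_eqVlt; apply/orP; left; apply/eqP; field; rewrite gt_eqF.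
have b2 : `|a0| * t ^+ 2 < eps / 4.
  apply: le_lt_trans (_ : 8 / eps * t ^+ 2 < _); first by rewrite ler_wpM2r // sqr_ge0.
  have -> : eps / 4 = 8 / eps * (eps ^+ 2 / 32) by field; rewrite gt_eqF.
  by rewrite ltr_pM2l // divr_gt0.
have b3 : t ^+ 2 <= 1 by nra.
have [a0p|a0n] := leP 0 a0.
  rewrite (ger0_norm a0p) in b1 b2 w1.
  exists j, i; split=> // [|a ea ae]; first by rewrite eq_sym.
  by apply: (side_pattern l k i j p q s t xi o cov kp kp' gap xi0 a0 eta _ t0 eta0 xie b3 _ b1 b2 w) => //; lra.
rewrite (ltr0_norm a0n) in b1 b2 w1.
have o' : ortho3 p q (- s) by split; rewrite ?dotNl ?dotNr ?opprK ?ps ?qs ?oppr0.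
exists i, j; split=> // a ea ae.
have gap' y : dot y p = 0 \/ dot y (p + t *: q) = 0 ->
    xi * `|dot y (- s)| < `|dot y q| -> ~ c l y.
  by rewrite dotNr normrN; exact: gap.
have w' b : `|b - - a0| < eps / 4 -> ~ c i (q + b *: - s).
  rewrite opprK scalerN -scaleNr => h; apply: w.
  by rewrite -normrN opprD !opprK.
have w1' : eta <= - a0 by lra.
have := side_pattern l k i j p q (- s) t xi o' cov kp kp' gap' xi0 (- a0) eta _ t0 eta0 xie b3 w1' b1 b2 w' a ea ae.
by rewrite scalerN opprK => -[].
Qed.

(** The cut-off at [1 / eta] avoids the cone around [s] where color [l] may occur; the one at [eta]
    is needed because the orthogonal partner [s - a *: q] has to avoid that cone too. *)
Definition pattern l i j q s (eta : R) := [/\ i != j, i != l, j != l &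
  forall a, eta < a -> a * eta < 1 -> c i (q + a *: s) /\ c j (q - a *: s)].

Lemma pattern_two_points l k e w s a b eta : ortho3 e w s -> l != k ->
  c k (e + a *: w) -> c k (e + b *: w) -> 0 <= a -> 0 <= b -> a != b ->
  `|a| <= eps / 16 -> `|b| <= eps / 16 -> 0 < eta -> eta <= eps / 8 ->
  (forall y, dot y (e + a *: w) = 0 \/ dot y (e + b *: w) = 0 -> c l y ->
     (1 - eta ^+ 2 / 16) * enorm y <= `|dot y s|) ->
  let n := Num.sqrt (1 + a ^+ 2) in
  exists i j, pattern l i j (n^-1 *: (w - a *: e)) s eta.
Proof.
move=> o lk ka kb a0 b0 ab ha hb eta0 etae gap n.
have e0 := eps0; have e1 := eps1.
have o' := ortho3_turn e w s a o; rewrite -/n /= in o'.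
have nn : n ^+ 2 = 1 + a ^+ 2 by rewrite sqr_sqrtr // addr_ge0 // sqr_ge0.
have n0 : 0 < n by rewrite sqrtr_gt0 ltr_wpDr // sqr_ge0.
have nn0 : n != 0 by rewrite gt_eqF.
have r0 : 0 < 1 + a * b by rewrite ltr_wpDr // mulr_ge0.
(* The tangent of the difference of the angles [atan b] and [atan a]: in the frame turned by
   [atan a], the second point is proportional to [p + t *: q]. *)
pose t := (b - a) / (1 + a * b).
set p := _ *: (e + _) in o' *; set q := _ *: (w - _) in o' *.
have ept : p + t *: q = (n / (1 + a * b)) *: (e + b *: w).
  rewrite /p /q /t scalerA !scalerDr scalerN !scalerA.
  rewrite [X in _ + X]addrC addrACA -scalerBl -scalerDl; congr (_ *: e + _ *: w).
    apply: (mulfI nn0); rewrite mulrA -expr2 nn; field; by rewrite nn0 gt_eqF.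
  rewrite [RHS]mulrAC; apply: (mulfI nn0); rewrite mulrA mulrA -expr2 nn; field; by rewrite nn0 gt_eqF.
have kp : c k p by apply: cZ => //; rewrite invr_eq0.
have kp' : c k (p + t *: q).
  by rewrite ept; apply: cZ => //; rewrite mulf_neq0 // invr_eq0 gt_eqF.
have t0 : t != 0.
  by apply: mulf_neq0; rewrite ?subr_eq0 ?invr_eq0 1?eq_sym // lt_eqF.
rewrite (ger0_norm a0) in ha; rewrite (ger0_norm b0) in hb.
have t1 : t ^+ 2 < eps ^+ 2 / 32.
  have : `|t| <= eps / 16.
    rewrite normrM normfV (gtr0_norm r0) ler_pdivrMr //.
    apply: le_trans (_ : eps / 16 <= _); first by rewrite ler_norml; apply/andP; split; lra.
    by rewrite ler_peMr ?lerDl ?mulr_ge0 //; lra.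
  rewrite -(real_normK (num_real t)) => h; have := normr_ge0 t => h0.
  apply: le_lt_trans (_ : (eps / 16) ^+ 2 < _).
    by rewrite ler_pXn2r // nnegrE; lra.
  by rewrite expr_div_n ltr_pM2l ?exprn_gt0 // ltf_pV2 ?posrE //; lra.
have [pp qq ss [pq ps qs]] := o'.
have xi0 : 0 < eta / 2 by lra.
apply: (core l k p q s t (eta / 2) eta) => //; first by lra.
move=> y hy hs cy.
have ly : (1 - eta ^+ 2 / 16) * enorm y <= `|dot y s|.
  apply: gap cy; case: hy => hy; [left|right]; move: hy.
    rewrite /p dotZr => /eqP; rewrite mulf_eq0 invr_eq0 (negPf nn0) /= => /eqP //.
  rewrite ept dotZr => /eqP; rewrite mulf_eq0 => /orP[|/eqP //].
  by rewrite mulf_eq0 invr_eq0 (negPf nn0) gt_eqF.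
have := bessel2 q s y qq ss qs.
rewrite -(real_normK (num_real (dot y q))) -(real_normK (num_real (dot y s))).
by apply: (cone_gap eta) => //; rewrite ?enorm_ge0 //; lra.
Qed.

Context (l : 'I_4).

(** * The dual cone of a color *)

(* [posc] picks the representatives of the lines of color [l] on the side of [d l],
   [dualc] is their dual cone, and [bdry] consists of its unit boundary points. *)
Definition posc x := c l x /\ 0 < dot (d l) x.
Definition dualc y := forall x, posc x -> 0 <= dot y x.
Definition bdry v := [/\ dot v v = 1, dualc v &
  forall k, 0 < k -> exists2 x, posc x & dot v x < k * enorm x].

Lemma c_neq0 i x : c i x -> x != 0.
Proof. by move=> h; apply: dot_neq0l (cO _ _ _ h h). Qed.

Lemma posc_d x : posc x -> eps * enorm x <= dot (d l) x.
Proof. by move=> [/dP h x0]; move: h; rewrite gtr0_norm. Qed.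

Lemma poscN x : c l x -> posc x \/ posc (- x).
Proof.
move=> cx; have cNx : c l (- x).
  by rewrite -scaleN1r; apply: cZ => //; rewrite oppr_eq0 oner_eq0.
have x0 : 0 < enorm x by rewrite enorm_gt0 (c_neq0 _ _ cx).
have h := dP _ _ cx; have e0 := eps0.
have [hx|hx] := leP 0 (dot (d l) x).
  left; split=> //; move: h; rewrite ger0_norm // => h.
  by apply: lt_le_trans h; rewrite mulr_gt0.
by right; split=> //; rewrite dotNr oppr_gt0.
Qed.

Lemma posc_unit x : posc x -> posc (unitv x).
Proof.
move=> [cx x0]; have n0 : 0 < enorm x by rewrite enorm_gt0 (c_neq0 _ _ cx).
split; first by apply: cZ => //; rewrite invr_eq0 gt_eqF.
by rewrite /unitv dotZr mulr_gt0 // invr_gt0.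
Qed.

(** A class need not be closed, so [dot y] may have no minimum on its unit representatives; the
    infimum [rho] and a [del]-minimizer [s] replace it. *)
Lemma near_minimizer y del : 0 < del -> (exists x, posc x) ->
  (forall x, posc x -> 0 <= dot y x) ->
  exists rho s, [/\ 0 <= rho, posc s, dot s s = 1, dot y s < rho + del &
    forall x, posc x -> rho * enorm x <= dot y x].
Proof.
move=> del0 [x0 px0] hy.
pose A := [set dot y x | x in [set x | posc x /\ dot x x = 1]].
have An : A !=set0.
  exists (dot y (unitv x0)); exists (unitv x0) => //; split; first exact: posc_unit.
  by apply/dot_unitv/(c_neq0 l); case: px0.
have lbA : lbound A 0 by move=> _ [x [px _] <-]; exact: hy.
have hA : has_inf A by split => //; exists 0.
have [_ [s [ps ss] <-] hs] := inf_adherent del0 hA.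
exists (inf A), s; split=> //; first exact: lb_le_inf.
move=> x px; have xn0 : x != 0 by apply: (c_neq0 l); case: px.
have n0 : 0 < enorm x by rewrite enorm_gt0.
rewrite mulrC -ler_pdivlMl //; have -> : (enorm x)^-1 * dot y x = dot y (unitv x) by rewrite dotZr.
apply: ge_inf; first by exists 0.
by exists (unitv x) => //; split; [exact: posc_unit | exact: dot_unitv].
Qed.

(** For [z] in [posc], [rho * dot s z = dot y z - dot b z >= (rho - m) * enorm z]: colored vectors
    almost orthogonal to [b] are almost parallel to [s]. *)
Lemma exposed_gap y b s (rho xi m : R) : 0 < rho -> 0 <= m -> m <= rho * xi ->
  b = y - rho *: s -> (forall x, posc x -> rho * enorm x <= dot y x) ->
  forall z, c l z -> `|dot b z| <= m * enorm z -> (1 - xi) * enorm z <= `|dot z s|.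
Proof.
move=> rho0 m0 mr bE rhoP.
have key z : posc z -> `|dot b z| <= m * enorm z -> (1 - xi) * enorm z <= dot s z.
  move=> pz; rewrite bE dotDl dotNl dotZl => /(le_trans (ler_norm _)) hz.
  rewrite -(ler_pM2l rho0); have := rhoP z pz; have := ler_wpM2r (enorm_ge0 z) mr.
  move: hz; rewrite !mulrBl mul1r mulrBr; lra.
move=> z cz hz; case: (poscN _ cz) => pz.
  by apply: le_trans (ler_norm _); rewrite (dotC z); exact: key.
rewrite -normrN -dotNl -enormN; apply: le_trans (ler_norm _); rewrite (dotC (- z)).
by apply: key => //; rewrite enormN dotNr normrN.
Qed.

(** A plane tilted by slope [t] away from the one orthogonal to [e] costs at most [2 * th], and the
    component of the vector along [s] at most [del]. *)
Lemma tilt_bound p0 e s w y (bs t del th : R) : p0 = enorm p0 *: e -> enorm p0 <= 2 ->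
  dot s s = 1 -> dot w w = 1 -> 0 <= bs -> bs <= del -> `|t| <= th ->
  dot y (e + t *: w) = 0 -> `|dot (p0 + bs *: s) y| <= (del + 2 * th) * enorm y.
Proof.
move=> p0E np0 ss ww bs0 bs1 ht hy.
have -> : dot (p0 + bs *: s) y = bs * dot s y - enorm p0 * t * dot w y.
  have h : dot e y = - (t * dot w y).
    by move: hy; rewrite dotDr dotZr (dotC y e) (dotC y w) => /eqP; rewrite addr_eq0 => /eqP.
  by rewrite dotDl p0E !dotZl h -p0E; ring.
apply: le_trans (ler_normB _ _) _; rewrite mulrDl.
have h1 := cauchy_schwarz s y; have h2 := cauchy_schwarz w y.
rewrite (enorm1 _ ss) mul1r in h1; rewrite (enorm1 _ ww) mul1r in h2.
apply: lerD; first by rewrite normrM (ger0_norm bs0) ler_pM ?normr_ge0.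
rewrite normrM normrM (ger0_norm (enorm_ge0 p0)).
apply: (ler_pM _ (normr_ge0 _) _ h2); first by rewrite mulr_ge0 ?enorm_ge0.
by rewrite ler_pM ?enorm_ge0 ?normr_ge0.
Qed.

(** [sig] is the whole error budget, one half for the near-minimizer and one half for tilting
    planes. Its own final factor [1 / 2] absorbs the loss in the lower bound for [rho]. *)
Lemma exposed_constants (eta sig rho : R) : 0 < eta -> eta <= eps / 8 ->
  sig = eta / 8 * eps * (eta ^+ 2 / 16) / 2 ->
  eta / 8 * eps - sig / 2 <= rho ->
  [/\ 0 < sig, sig <= eta / 128, 0 < rho & sig <= rho * (eta ^+ 2 / 16)].
Proof.
move=> eta0 etae sigE h; have e1 := eps1; have e0 := eps0.
have f0 : 0 < eta ^+ 2 by rewrite exprn_gt0.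
have f1 : eta ^+ 2 <= 1 by rewrite expr_le1 //; lra.
have k0 : 0 < eta * eps by rewrite mulr_gt0.
have k1 : eta * eps <= eta by rewrite ler_piMr // ltW.
have E : sig = eta * eps * eta ^+ 2 / 256 by rewrite sigE; field.
have s0 : 0 < sig by rewrite E !mulr_gt0 // invr_gt0.
have s1 : sig <= eta * eps / 256 by rewrite E ler_pM2r ?invr_gt0 // ler_piMr // ltW.
have r1 : eta * eps / 16 <= rho by lra.
split=> //; [lra|lra|].
rewrite E; apply: le_trans (_ : eta * eps / 16 * (eta ^+ 2 / 16) <= _).
  by rewrite le_eqVlt; apply/orP; left; apply/eqP; field.
by rewrite ler_pM2r // divr_gt0.
Qed.

Lemma exposed_numeric (eta sig r : R) : 0 < eta -> eta <= eps / 8 -> 0 < sig -> sig <= eta / 128 ->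
  `|r - 1| <= eta / 8 * 3 + sig / 2 ->
  [/\ 0 < r, r <= 2, `|1 - r| + (eta / 8 * 3 + sig / 2) + 6 * (sig / 12) < eta,
      0 < sig / 12 & 3 * (sig / 12) <= eps / 16].
Proof.
move=> eta0 etae s0 s1 hr; have e1 := eps1; have e0 := eps0.
have hr' := hr; rewrite distrC in hr'; move: hr; rewrite ler_norml => /andP[r1 r2].
by split; lra.
Qed.

(* Near a boundary point [v] of the dual cone, shifting [v] slightly towards the
   center and subtracting a near-minimizing colored direction [s] exposes [s]:
   on the planes almost orthogonal to [e] all points of color [l] are close to [s]. *)
Lemma bdry_exposed v (eta : R) : bdry v -> 0 < eta -> eta <= eps / 8 ->
  exists e s th, [/\ ortho3 e (cross e s) s, posc s, 0 < th /\ 3 * th <= eps / 16,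
    enorm (e - v) + 6 * th < eta &
    forall t y, 0 <= t -> t <= 3 * th -> dot y (e + t *: cross e s) = 0 -> c l y ->
      (1 - eta ^+ 2 / 16) * enorm y <= `|dot y s|].
Proof.
move=> [vv vK vb] eta0 etae.
(* Without this shift towards [d l] the infimum [rho] could be 0, and subtracting [rho *: s] would
   expose nothing. *)
pose kap := eta / 8; have kap0 : 0 < kap by rewrite divr_gt0.
pose y := v + kap *: d l.
have nd : enorm (d l) = 1 by exact/enorm1/d1.
have yP x : posc x -> kap * eps * enorm x <= dot y x.
  move=> px; rewrite /y dotDl dotZl -mulrA -[leLHS]add0r lerD ?vK //.
  by rewrite ler_pM2l // posc_d.
have yP0 x : posc x -> 0 <= dot y x.
  move=> /yP; apply: le_trans; apply: mulr_ge0 (enorm_ge0 _).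
  by apply: mulr_ge0; exact: ltW.
have [x0 px0 hx0] := vb kap kap0.
have [sig sigE] : exists sig, sig = eta / 8 * eps * (eta ^+ 2 / 16) / 2 by eexists.
have del0 : 0 < sig / 2.
  by rewrite sigE !mulr_gt0 ?invr_gt0 // exprn_gt0.
have [rho [s [rho0 ps ss hs rhoP]]] := near_minimizer y (sig / 2) del0 (ex_intro _ x0 px0) yP0.
have ns : enorm s = 1 by apply: enorm1.
have rho_ge : eta / 8 * eps - sig / 2 <= rho.
  by have := yP s ps; rewrite ns mulr1 lerBlDr => h; apply: le_trans h (ltW hs).
have [sig0 sig1 rho1 sig_rho] := exposed_constants eta sig rho eta0 etae sigE rho_ge.
(* Since [v] nearly annihilates [x0], only the shift contributes to [dot y x0]; so [rho] is of order
   [kap], and [b] stays close to [v]. *)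
have rho_le : rho <= 2 * kap.
  have xn0 : 0 < enorm x0 by rewrite enorm_gt0; apply: (c_neq0 l); case: px0.
  rewrite -(ler_pM2r xn0) mulrDl mul1r mulrDl; apply: le_trans (rhoP x0 px0) _.
  rewrite /y dotDl dotZl lerD ?(ltW hx0) // ler_pM2l //.
  by have := dot_le_enorm (d l) x0; rewrite nd mul1r.
have [b bE] : exists b, b = y - rho *: s by eexists.
have bs0 : 0 <= dot b s.
  by rewrite bE dotDl dotNl dotZl ss mulr1 subr_ge0; have := rhoP s ps; rewrite ns mulr1.
have bs1 : dot b s <= sig / 2.
  by rewrite bE dotDl dotNl dotZl ss mulr1 lerBlDl ltW.
(* Removing the component along [s], which is at most [sig / 2], makes the pole [e] orthogonal to
   [s]. *)
have [p0 p0E] : exists p0, p0 = b - dot b s *: s by eexists.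
have p0s : dot p0 s = 0 by rewrite p0E dotDl dotNl dotZl ss mulr1 subrr.
have nb : enorm (b - v) <= kap + rho.
  have -> : b - v = kap *: d l + (- rho) *: s by rewrite bE /y scaleNr addrAC (addrC v) addrK.
  apply: le_trans (enormD _ _) _; rewrite !enormZ nd ns normrN !mulr1.
  by rewrite (gtr0_norm kap0) (ger0_norm rho0).
have nbp : enorm (p0 - b) <= sig / 2.
  have -> : p0 - b = (- dot b s) *: s by rewrite p0E scaleNr addrC addKr.
  by rewrite enormZ ns mulr1 normrN ger0_norm.
have np0v : enorm (p0 - v) <= kap * 3 + sig / 2.
  apply: le_trans (enorm_dist p0 b v) _; rewrite addrC lerD //; apply: le_trans nb _.
  have -> : kap * 3 = kap + 2 * kap by ring.
  by rewrite lerD2l.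
have np0 := le_trans (enormBB p0 v) np0v; rewrite (enorm1 _ vv) in np0.
have [r0 r2 rd th0 th1] := exposed_numeric eta sig (enorm p0) eta0 etae sig0 sig1 np0.
have p00 : p0 != 0 by rewrite -enorm_gt0.
have [e eE] : exists e, e = unitv p0 by eexists.
have ee : dot e e = 1 by rewrite eE dot_unitv.
have es : dot e s = 0 by rewrite eE /unitv dotZl p0s mulr0.
have o := ortho3_cross e s ee ss es.
exists e, s, (sig / 12); split=> //.
  apply: le_lt_trans rd; rewrite lerD2r; apply: le_trans (enorm_dist e p0 v) _.
  by rewrite eE (unitv_dist _ p00) lerD2l.
move=> t z t0 t1 hz cz; have [_ ww _ _] := o.
apply: (exposed_gap y b s rho _ sig rho1 (ltW sig0) sig_rho bE rhoP z cz).
have -> : b = p0 + dot b s *: s by rewrite p0E subrK.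
have -> : sig = sig / 2 + 2 * (3 * (sig / 12)) by field.
apply: tilt_bound hz => //; last by rewrite ger0_norm.
by rewrite eE unitvK.
Qed.

(** The four points [e + (m%:R * th) *: w] are orthogonal to [s], hence miss color [l], so two of
    them share a color [k]. All have slope at most [3 * th], within the range of the exposed gap. *)
Lemma bdry_approx v eta : bdry v -> 0 < eta -> eta <= eps / 8 ->
  exists p q s i j, [/\ ortho3 p q s, enorm (p - v) < eta, posc s & pattern l i j q s eta].
Proof.
move=> bv eta0 etae.
have [e [s [th [o ps [th0 th1] hd gap]]]] := bdry_exposed v eta bv eta0 etae.
set w := cross e s in o gap; have [ee ww ss [ew _ ws]] := o.
have nw : enorm w = 1 by apply: enorm1.
pose Q (m : 'I_4) := e + (m%:R * th) *: w.
have Q0 m : Q m != 0.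
  apply/eqP => /(congr1 (dot e)); rewrite /Q dotDr dotZr ee ew dot0r mulr0 addr0.
  by move/eqP; rewrite oner_eq0.
pose f m := projT1 (cid (cE _ (Q0 m))).
have fP m : c (f m) (Q m) by exact: projT2 (cid (cE _ (Q0 m))).
have fl m : f m != l.
  apply/eqP => fm; have := fP m; rewrite fm => h; have := cO _ _ _ h ps.1.
  by rewrite /Q dotDl dotZl ws; case: o => _ _ _ [_ -> _]; rewrite mulr0 addr0 eqxx.
have [m [m' [mm' fmm']]] := not_inj4 f l fl.
have m0 (n : 'I_4) : 0 <= n%:R * th by rewrite mulr_ge0 ?ler0n // ltW.
have m1 (n : 'I_4) : n%:R * th <= 3 * th.
  by rewrite ler_pM2r // (ler_nat R _ 3) -ltnS; exact: ltn_ord.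
have m2 (n : 'I_4) : `|n%:R * th| <= eps / 16 by rewrite ger0_norm // (le_trans (m1 n)).
have gap' y : dot y (Q m) = 0 \/ dot y (Q m') = 0 -> c l y ->
    (1 - eta ^+ 2 / 16) * enorm y <= `|dot y s|.
  by case=> hy cy; [apply: (gap (m%:R * th))|apply: (gap (m'%:R * th))].
have ab : m%:R * th != m'%:R * th.
  by rewrite (inj_eq (mulIf (lt0r_neq0 th0))) eqr_nat.
have lk : l != f m by rewrite eq_sym.
have km' : c (f m) (Q m') by rewrite fmm'.
have [i [j pat]] := pattern_two_points l (f m) e w s _ _ eta
  o lk (fP m) km' (m0 m) (m0 m') ab (m2 m) (m2 m') eta0 etae gap'.
have o' := ortho3_turn e w s (m%:R * th) o.
eexists _, _, s, i, j; split; [exact: o'| | by [] | exact: pat].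
rewrite -(enorm_turn e w s) // -/(Q m) -/(unitv (Q m)).
apply: le_lt_trans hd; apply: le_trans (enorm_dist _ (Q m) _) _.
have Qe : enorm (Q m - e) <= 3 * th.
  by rewrite /Q addrAC subrr add0r enormZ nw mulr1 ger0_norm.
have -> : enorm (e - v) + 6 * th = 3 * th + (3 * th + enorm (e - v)) by ring.
apply: lerD.
  have h := enormBB (Q m) e; rewrite (enorm1 _ ee) distrC in h.
  by rewrite (unitv_dist _ (Q0 m)); exact: le_trans h Qe.
by apply: le_trans (enorm_dist _ e _) _; rewrite lerD2r.
Qed.

(** * Limiting color patterns at boundary points *)

Lemma pattern_le i j q s (eta eta' : R) : 0 < eta -> eta <= eta' ->
  pattern l i j q s eta -> pattern l i j q s eta'.
Proof.
move=> e0 ee [ij il jl h]; split=> // a a1 a2; apply: h; first lra.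
by apply: le_lt_trans a2; rewrite ler_pM2l //; lra.
Qed.

(* [v] is a boundary point of the dual cone with normal [r], [t] is tangent, and in
   the limit the open quarter circles from [r] to [t] and from [r] to [- t] have
   colors [i] and [j]. *)
Definition edge v r t i j := forall eta, 0 < eta -> exists p s q,
  [/\ [/\ enorm (p - v) < eta, enorm (s - r) < eta & enorm (q - t) < eta],
      ortho3 p q s, posc s & pattern l i j q s eta].

(** The pair of colors is the finite label of the compactness argument, so normal, tangent and both
    colors are fixed together. *)
Lemma edge_exists v : bdry v -> exists r t i j, edge v r t i j.
Proof.
move=> bv; pose Q eta s q (k : 'I_4 * 'I_4) := exists eta' p, [/\ 0 < eta', eta' <= eta,
  enorm (p - v) < eta, ortho3 p q s & posc s /\ pattern l k.1 k.2 q s eta'].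
have [eta eta' u w k ee|eta e0|r [t [k [rr tt hk]]]] := cluster_unit2 _ Q.
- by move=> [e [p [h1 h2 h3 h4 h5]]]; exists e, p; split=> //; lra.
- pose eta' := Num.min eta (eps / 8).
  have e1 : eta' <= eta by rewrite ge_min lexx.
  have e2 : eta' <= eps / 8 by rewrite ge_min lexx orbT.
  have e3 : 0 < eta' by rewrite lt_min e0 divr_gt0.
  have [p [q [s [i [j [o h1 h2 h3]]]]]] :=
    bdry_approx v eta' bv e3 e2.
  have [_ qq ss _] := o.
  by exists s, q, (i, j); split=> //; exists eta', p; split=> //; lra.
exists r, t, k.1, k.2 => eta e0.
have [s [q [_ _ hs hq [eta' [p [h1 h2 h3 h4 [h5 h6]]]]]]] := hk _ e0.
by exists p, s, q; split=> //; exact: pattern_le h6.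
Qed.

Lemma edge_lim v r t i j : (forall eta, 0 < eta -> exists v1 r1 t1,
    [/\ enorm (v1 - v) < eta, enorm (r1 - r) < eta, enorm (t1 - t) < eta & edge v1 r1 t1 i j]) ->
  edge v r t i j.
Proof.
move=> h eta e0; have e2 : 0 < eta / 2 by lra.
have [v1 [r1 [t1 [hv hr ht he]]]] := h _ e2.
have [p [s [q [[hp hs hq] o ps pat]]]] := he _ e2.
exists p, s, q; split=> //; last by apply: pattern_le pat => //; lra.
split.
- by have := enorm_dist p v1 v; lra.
- by have := enorm_dist s r1 r; lra.
- by have := enorm_dist q t1 t; lra.
Qed.

Lemma edge_turn v r t i j : edge v r t i j -> edge v r (- t) j i.
Proof.
move=> h eta e0; have [p [s [q [[hp hs hq] [pp qq ss [pq ps' qs]] ps [ij il jl pat]]]]] := h _ e0.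
exists p, s, (- q); split=> //.
- by split=> //; rewrite -opprD enormN.
- by split; rewrite ?dotNl ?dotNr ?opprK // ?pq ?qs ?oppr0.
split=> // [|a a1 a2]; first by rewrite eq_sym.
have [h1 h2] := pat _ a1 a2; split.
  by rewrite addrC -opprB -scaleN1r; apply: cZ; rewrite ?oppr_eq0 ?oner_eq0.
by rewrite -opprD -scaleN1r; apply: cZ; rewrite ?oppr_eq0 ?oner_eq0.
Qed.

Lemma dot_approx x y x' y' (eta : R) : enorm (x' - x) <= eta -> enorm (y' - y) <= eta ->
  `|dot x' y' - dot x y| <= eta * (enorm x' + enorm y).
Proof.
move=> hx hy.
have -> : dot x' y' - dot x y = dot (x' - x) y + dot x' (y' - y) by rewrite !dotL; ring.
apply: le_trans (ler_normD _ _) _; rewrite addrC mulrDr.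
apply: lerD; apply: le_trans (cauchy_schwarz _ _) _; last by rewrite ler_wpM2r // enorm_ge0.
by rewrite mulrC ler_wpM2r // enorm_ge0.
Qed.

Lemma edge_dual v r t i j y : edge v r t i j -> dualc y -> 0 <= dot y r.
Proof.
move=> he yd; rewrite leNgt; apply/negP => yr.
have [eta e0 h] : exists2 eta, 0 < eta & eta * enorm y < - dot y r.
  exists (- dot y r / (enorm y + 1)).
    by rewrite divr_gt0 //; have := enorm_ge0 y; lra.
  have ny := enorm_ge0 y.
  rewrite mulrAC ltr_pdivrMr; last lra.
  by rewrite ltr_pM2l; lra.
have [p [s [q [[_ hs _] _ /yd ps _]]]] := he _ e0.
have := dot_le_enorm y (s - r); rewrite dotDr dotNr mulrC.
have := enorm_ge0 y => ny; have := ler_wpM2r ny (ltW hs); lra.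
Qed.

Lemma enorm_eq x (a : R) : 0 <= a -> (forall eta, 0 < eta -> `|enorm x - a| < eta) -> dot x x = a ^+ 2.
Proof. by move=> a0 /small_eq0 h; rewrite -enorm_sq -[enorm x](subrK a) h add0r. Qed.

Lemma edge_ortho v r t i j : edge v r t i j -> ortho3 v t r.
Proof.
move=> he.
have nrm x : (forall eta, 0 < eta -> exists x', dot x' x' = 1 /\ enorm (x' - x) < eta) -> dot x x = 1.
  move=> h; rewrite (enorm_eq x 1) ?expr1n // => eta /h[x' [xx hx]].
  by apply: le_lt_trans hx; rewrite -(enorm1 _ xx) distrC enormBB.
have ort x y : dot y y = 1 -> (forall eta, 0 < eta -> exists x' y',
   [/\ dot x' x' = 1, dot x' y' = 0, enorm (x' - x) < eta & enorm (y' - y) < eta]) -> dot x y = 0.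
  move=> yy h; apply: small_eq0 => eta e0; have e4 : 0 < eta / 4 by lra.
  have [x' [y' [xx xy hx hy]]] := h _ e4.
  have := dot_approx x y x' y' (eta / 4) (ltW hx) (ltW hy).
  by rewrite xy (enorm1 _ xx) (enorm1 _ yy) sub0r normrN; lra.
have vv : dot v v = 1.
  by apply: nrm => eta /he[p [s [q [[h _ _] [pp _ _ _] _ _]]]]; exists p.
have tt : dot t t = 1.
  by apply: nrm => eta /he[p [s [q [[_ _ h] [_ qq _ _] _ _]]]]; exists q.
have rr : dot r r = 1.
  by apply: nrm => eta /he[p [s [q [[_ h _] [_ _ ss _] _ _]]]]; exists s.
split=> //; split; apply: ort => // eta /he[p [s [q [[h1 h2 h3] [pp qq ss [pq ps qs]] _ _]]]].
- by exists p, q.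
- by exists p, s.
- by exists q, s.
Qed.

Lemma edge_center v r t i j : edge v r t i j -> eps <= dot (d l) r.
Proof.
move=> he; rewrite leNgt; apply/negP => yr.
have e0 : 0 < eps - dot (d l) r by lra.
have [p [s [q [[_ hs _] [_ _ ss _] ps _]]]] := he _ e0.
have := posc_d s ps; rewrite (enorm1 _ ss).
have := dot_le_enorm (d l) (s - r); rewrite dotDr dotNr (enorm1 _ (d1 l)); lra.
Qed.

Lemma edge_colors v r t i j : edge v r t i j -> [/\ i != j, i != l & j != l].
Proof. by move=> /(_ 1 ltr01)[p [s [q [_ _ _ []]]]]. Qed.

(** * Sign conditions between arcs of one color *)

Definition arc r t i := forall eta, 0 < eta -> exists s q,
  [/\ enorm (s - r) < eta, enorm (q - t) < eta &
      forall a, eta < a -> a * eta < 1 -> c i (q + a *: s)].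

Lemma edge_arc v r t i j : edge v r t i j -> arc r t i.
Proof.
move=> he eta /he[p [s [q [[h1 h2 h3] _ _ [_ _ _ pat]]]]].
by exists s, q; split=> // a a1 a2; exact: (pat a a1 a2).1.
Qed.

Lemma edge_arcN v r t i j : edge v r t i j -> arc r (- t) j.
Proof. by move=> /edge_turn/edge_arc. Qed.

(** Closed on purpose: it contains the end vectors [t] and [r], where no color is known but where
    signs are easiest to test. *)
Definition conic r t x := exists a b : R, [/\ 0 <= a <= 1, 0 <= b <= 1 & x = a *: t + b *: r].

Lemma conicl r t : conic r t r.
Proof. by exists 0, 1; rewrite scale0r add0r scale1r !lexx !ler01. Qed.

Lemma conicr r t : conic r t t.
Proof. by exists 1, 0; rewrite scale0r addr0 scale1r !lexx !ler01. Qed.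

(** Adding [k] to both coefficients leaves the ends of the cone: coefficients in [[k, 2]] have
    ratios between [k / 2] and [2 / k], inside the range colored at scale [k / 4]. The shift costs
    [2 * k] and the change of frame [k]. *)
Lemma conic_perturb u w z u' w' (k eta : R) : 0 < k -> k <= 1 -> eta <= k / 4 ->
  dot u u = 1 -> dot w w = 1 -> conic u w z ->
  enorm (u' - u) < eta -> enorm (w' - w) < eta -> exists a b,
  [/\ k <= a <= 2, k <= b <= 2 & enorm (a *: w' + b *: u' - z) <= 3 * k].
Proof.
move=> k0 k1 ek uu ww [a [b [/andP[a0 a1] /andP[b0 b1] ->]]] hu hw.
exists (a + k), (b + k); split; try by apply/andP; split; lra.
have -> : (a + k) *: w' + (b + k) *: u' - (a *: w + b *: u) =
   (a + k) *: (w' - w) + (b + k) *: (u' - u) + (k *: w + k *: u).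
  by apply/rowP => m; rewrite !mxE; ring.
apply: le_trans (enormD _ _) _; apply: le_trans (lerD (enormD _ _) (enormD _ _)) _.
have ak : 0 <= a + k by lra.
have bk : 0 <= b + k by lra.
rewrite !enormZ (enorm1 _ uu) (enorm1 _ ww) (gtr0_norm k0) (ger0_norm ak) (ger0_norm bk).
have h1 : (a + k) * enorm (w' - w) <= 2 * eta.
  by apply: (ler_pM ak (enorm_ge0 _) _ (ltW hw)); lra.
have h2 : (b + k) * enorm (u' - u) <= 2 * eta.
  by apply: (ler_pM bk (enorm_ge0 _) _ (ltW hu)); lra.
lra.
Qed.

Lemma segment_bounds (k a b f : R) : 0 <= f -> f <= 1 -> k <= a <= 2 -> k <= b <= 2 ->
  k <= (1 - f) * a + f * b <= 2.
Proof.
move=> f0 f1 /andP[a1 a2] /andP[b1 b2]; have g0 : 0 <= 1 - f by rewrite subr_ge0.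
have h1 := ler_wpM2l g0 a1; have h2 := ler_wpM2l f0 b1.
have h3 := ler_wpM2l g0 a2; have h4 := ler_wpM2l f0 b2.
by apply/andP; split; lra.
Qed.

Lemma conic_color n u w (k a b a' b' f : R) : 0 < k ->
  (forall x : R, k / 4 < x -> x * (k / 4) < 1 -> c n (w + x *: u)) ->
  k <= a <= 2 -> k <= b <= 2 -> k <= a' <= 2 -> k <= b' <= 2 -> 0 <= f -> f <= 1 ->
  c n ((1 - f) *: (a *: w + b *: u) + f *: (a' *: w + b' *: u)).
Proof.
move=> k0 Q ha hb ha' hb' f0 f1.
have := segment_bounds _ _ _ _ f0 f1 ha ha'; have := segment_bounds _ _ _ _ f0 f1 hb hb'.
have -> : (1 - f) *: (a *: w + b *: u) + f *: (a' *: w + b' *: u) =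
    ((1 - f) * a + f * a') *: w + ((1 - f) * b + f * b') *: u.
  by apply/rowP => i; rewrite !mxE; ring.
move: (_ * a + _) (_ * b + _) => al be /andP[be1 be2] /andP[al1 al2].
have al0 : 0 < al := lt_le_trans k0 al1.
have -> : al *: w + be *: u = al *: (w + (be / al) *: u).
  by rewrite scalerDr scalerA [al * _]mulrC divfK ?gt_eqF.
apply: cZ; first by rewrite gt_eqF.
apply: Q; first by rewrite ltr_pdivlMr //; nra.
by rewrite mulrAC ltr_pdivrMr // mul1r; nra.
Qed.

(** Both strict signs persist on nearby frames, where the vectors concerned really have color [i].
    Moving inside the two colored cones from the acute pair to the obtuse one crosses an orthogonal
    pair of color [i]. *)
Lemma arc_sign r t r' t' i : dot r r = 1 -> dot t t = 1 -> dot r' r' = 1 -> dot t' t' = 1 ->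
  arc r t i -> arc r' t' i ->
  forall x x' y y', conic r t x -> conic r' t' x' -> conic r t y -> conic r' t' y' ->
  0 < dot x x' -> dot y y' < 0 -> False.
Proof.
move=> rr tt rr' tt' A A' x x' y y' cx cx' cy cy' xx yy.
have [e1 e10 h1] := dot_near _ _ xx.
have yyN : 0 < dot y (- y') by rewrite dotNr oppr_gt0.
have [e2 e20 h2] := dot_near _ _ yyN.
pose k := Num.min 1 (Num.min (e1 / 8) (e2 / 8)).
have k0 : 0 < k by rewrite !lt_min ltr01 !divr_gt0.
have [k1 k2 k3] : [/\ k <= 1, k <= e1 / 8 & k <= e2 / 8].
  by split; rewrite !ge_min lexx ?orbT.
pose eta := k / 4; have eta0 : 0 < eta by rewrite /eta; lra.
have [s [q [hs hq P]]] := A _ eta0; have [s' [q' [hs' hq' P']]] := A' _ eta0.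
have [a0 [b0 [ha0 hb0 X]]] := conic_perturb _ _ _ _ _ _ _ k0 k1 (lexx _) rr tt cx hs hq.
have [a1 [b1 [ha1 hb1 Y]]] := conic_perturb _ _ _ _ _ _ _ k0 k1 (lexx _) rr tt cy hs hq.
have [a0' [b0' [ha0' hb0' X']]] := conic_perturb _ _ _ _ _ _ _ k0 k1 (lexx _) rr' tt' cx' hs' hq'.
have [a1' [b1' [ha1' hb1' Y']]] := conic_perturb _ _ _ _ _ _ _ k0 k1 (lexx _) rr' tt' cy' hs' hq'.
have l1 : 3 * k < e1 by lra.
have l2 : 3 * k < e2 by lra.
have p1 : 0 < dot (a0 *: q + b0 *: s) (a0' *: q' + b0' *: s').
  by apply: h1; exact: le_lt_trans l1.
have p2 : dot (a1 *: q + b1 *: s) (a1' *: q' + b1' *: s') < 0.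
  rewrite -oppr_gt0 -dotNr; apply: h2; first exact: le_lt_trans l2.
  by rewrite -opprD enormN; exact: le_lt_trans l2.
have [m [m' [/andP[m0 m1] /andP[m0' m1'] e]]] := bilinear_root _ _ _ _ p1 p2.
have c1 : c i ((1 - m) *: (a0 *: q + b0 *: s) + m *: (a1 *: q + b1 *: s)) by exact: (conic_color _ _ _ k).
have c2 : c i ((1 - m') *: (a0' *: q' + b0' *: s') + m' *: (a1' *: q' + b1' *: s')) by exact: (conic_color _ _ _ k).
by have := cO _ _ _ c1 c2; rewrite e eqxx.
Qed.

(** As [r] and [r'] are acute, no pair from the two arcs of color [i], or from the two of color [j],
    is obtuse. Testing [r'] against [t] and [- t] gives [r'] orthogonal to [t], and similarly [r] to
    [t']; duality then removes the component of [r'] along [v]. *)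
Lemma edge_rigid v r t v' r' t' i j : edge v r t i j -> edge v' r' t' i j ->
  dualc v -> dualc v' -> 0 < dot r r' -> 0 < dot v v' -> r' = r.
Proof.
move=> e e' dv dv' rr' vv'.
have o := edge_ortho _ _ _ _ _ e; have o' := edge_ortho _ _ _ _ _ e'.
have [vv tt rr [vt vr tr]] := o; have [vv1 tt1 rr1 [vt1 vr1 tr1]] := o'.
have S := arc_sign r t r' t' i rr tt rr1 tt1 (edge_arc _ _ _ _ _ e) (edge_arc _ _ _ _ _ e').
have ttN : dot (- t) (- t) = 1 by rewrite dotNl dotNr opprK.
have ttN1 : dot (- t') (- t') = 1 by rewrite dotNl dotNr opprK.
have SN := arc_sign r (- t) r' (- t') j rr ttN rr1 ttN1 (edge_arcN _ _ _ _ _ e) (edge_arcN _ _ _ _ _ e').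
have C := conicl; have D := conicr.
have tr0 : dot r' t = 0.
  apply/eqP; rewrite eq_le !leNgt dotC; apply/andP; split; apply/negP => h.
    by apply: (SN r r' (- t) r') => //; rewrite dotNl oppr_lt0.
  by apply: (S r r' t r').
have rt0 : dot r t' = 0.
  apply/eqP; rewrite eq_le !leNgt; apply/andP; split; apply/negP => h.
    by apply: (SN r r' r (- t')) => //; rewrite dotNr oppr_lt0.
  by apply: (S r r' r t').
have E' := ortho3_exp _ _ _ r' o; have E := ortho3_exp _ _ _ r o'.
rewrite tr0 scale0r addr0 in E'; rewrite rt0 scale0r addr0 in E.
have b0 : 0 <= dot r' v by rewrite dotC; exact: edge_dual e' dv.
have b1 : 0 <= dot r v' by rewrite dotC; exact: edge_dual e dv'.
(* This writes [dot v r = 0] as a sum of two nonnegative products, so both vanish; [dot r r'] being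
   positive, [dot r' v = 0]. *)
have := congr1 (dot v) E; rewrite vr dotDr !dotZr (dotC v r') => h.
have b00 : dot r' v = 0.
  by have : 0 <= dot r v' * dot v v' by [exact: mulr_ge0 b1 (ltW vv')]; nra.
rewrite b00 scale0r add0r in E'.
have := rr1; rewrite E' !dotL rr mulr1 -expr2 => /eqP.
rewrite sqrf_eq1 dotC => /orP[/eqP -> |/eqP h']; first by rewrite scale1r.
by move: rr'; rewrite h' oppr_gt0 ltr10.
Qed.

Lemma color_pigeonhole (i j i' j' : 'I_4) : i != j -> i != l -> j != l ->
  i' != j' -> i' != l -> j' != l -> [\/ i = i', j = j', i = j' | j = i'].
Proof.
move=> ij il jl ij' il' jl'.
have [/eqP e|h1] := boolP (i == i'); first by constructor 1.
have [/eqP e|h2] := boolP (j == j'); first by constructor 2.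
have [/eqP e|h3] := boolP (i == j'); first by constructor 3.
have [/eqP e|h4] := boolP (j == i'); first by constructor 4.
have u : uniq [:: l; i; j; i'; j'].
  by rewrite /= !inE !negb_or !(eq_sym l) il jl il' jl' ij h1 h3 h4 h2 ij'.
by have := max_card (mem [:: l; i; j; i'; j']); rewrite (card_uniqP u) card_ord.
Qed.

(** Up to the sign of [t'], the two frames of [v^perp] differ by a rotation with cosine [C] and sine
    [S]. Both color pairs avoid [l], so they overlap. If arcs in the same position share a color,
    the products of [t], [r'] and of [r], [t'] are [S] and [- S] up to a common sign; if opposite
    arcs do, [r], [r'] and a pair of tangents give [C] and [- C]. The sign rule makes [S] or [C]
    vanish, and [S = 0] would mean [r' = r] or [r' = - r], the latter being excluded by
    [edge_center]. *)
Lemma edge_corner v r t r' t' i j i' j' : edge v r t i j -> edge v r' t' i' j' ->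
  r' != r -> dot r r' = 0.
Proof.
move=> e e' rr'.
have o := edge_ortho _ _ _ _ _ e; have o' := edge_ortho _ _ _ _ _ e'.
have [vv tt rr [vt vr tr]] := o; have [_ tt1 rr1 [vt1 vr1 tr1]] := o'.
set C := dot r r'.
pose S := dot t r'; have [w wE] : exists w, w = C *: t - S *: r by eexists.
have E := ortho3_exp _ _ _ r' o.
rewrite (dotC r' v) vr1 scale0r add0r (dotC r' t) (dotC r' r) -/S -/C in E.
have CS : C ^+ 2 + S ^+ 2 = 1.
  by have := rr1; rewrite E !dotL tt rr (dotC r t) tr => <-; ring.
have ow : ortho3 v w r'.
  split=> //; first by rewrite wE !dotL tt rr (dotC r t) tr -[RHS]CS; ring.
  split=> //; first by rewrite wE !dotL vt vr; ring.
  by rewrite wE E !dotL tt rr (dotC r t) tr; ring.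
have T := ortho3_exp _ _ _ t' ow.
rewrite (dotC t' v) vt1 scale0r add0r tr1 scale0r addr0 in T.
have S0 : S != 0.
  apply/eqP => S0; move: CS E; rewrite S0 expr0n addr0 scale0r add0r => /eqP.
  rewrite sqrf_eq1 => /orP[]/eqP -> E; first by move/eqP: rr'; rewrite E scale1r.
  have h1 := edge_center _ _ _ _ _ e; have h2 := edge_center _ _ _ _ _ e'.
  rewrite E dotZr mulN1r in h2; have := lerD h1 h2.
  by rewrite subrr leNgt addr_gt0.
wlog tw : t' i' j' e' o' tt1 vt1 tr1 T / dot t' w = 1.
  move=> W; have : dot t' w ^+ 2 = 1.
    have [_ ww _ _] := ow; by rewrite -tt1 {2 3}T !dotL ww mulr1.
  move=> /eqP; rewrite sqrf_eq1 => /orP[]/eqP tw; first exact: (W t' i' j').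
  apply: (W (- t') j' i') => //.
  - exact: edge_turn.
  - exact: edge_ortho (edge_turn _ _ _ _ _ e').
  - by rewrite dotNl dotNr opprK.
  - by rewrite dotNr vt1 oppr0.
  - by rewrite dotNl tr1 oppr0.
  - by rewrite dotNl scaleNr -T.
  - by rewrite dotNl tw opprK.
rewrite tw scale1r in T.
have rt1 : dot r t' = - S. rewrite T wE !dotL rr (dotC r t) tr; ring.
have tt' : dot t t' = C by rewrite T wE !dotL tt tr; ring.
have ttN : dot (- t) (- t) = 1 by rewrite dotNl dotNr opprK.
have ttN1 : dot (- t') (- t') = 1 by rewrite dotNl dotNr opprK.
have K := conicl; have L := conicr.
have A := edge_arc _ _ _ _ _ e; have B := edge_arcN _ _ _ _ _ e.
have A' := edge_arc _ _ _ _ _ e'; have B' := edge_arcN _ _ _ _ _ e'.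
have S_neq0 n u u' : dot u u = 1 -> dot u' u' = 1 -> arc r u n -> arc r' u' n ->
    dot r u' = - dot u r' -> dot u r' = 0.
  move=> uu uu1 a1 a2 h; apply/eqP; have H := arc_sign r u r' u' n rr uu rr1 uu1 a1 a2.
  case: (ltrgtP (dot u r') 0) => // h'; [case: (H r u' u r')|case: (H u r' r u')] => //.
    by rewrite h oppr_gt0.
  by rewrite h oppr_lt0.
have C_eq0 n u u' : dot u u = 1 -> dot u' u' = 1 -> arc r u n -> arc r' u' n ->
    dot u u' = - C -> C = 0.
  move=> uu uu1 a1 a2 h; apply/eqP; have H := arc_sign r u r' u' n rr uu rr1 uu1 a1 a2.
  case: (ltrgtP C 0) => // h'; [case: (H u u' r r')|case: (H r r' u u')] => //.
    by rewrite h oppr_gt0.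
  by rewrite h oppr_lt0.
have [ij il jl] := edge_colors _ _ _ _ _ e; have [ij' il' jl'] := edge_colors _ _ _ _ _ e'.
have [q|q|q|q] := color_pigeonhole i j i' j' ij il jl ij' il' jl'.
- by move/eqP: S0; case; apply: (S_neq0 i' t t') => //; rewrite -q.
- move/eqP: S0; case; apply: oppr_inj; rewrite -dotNl oppr0.
  apply: (S_neq0 j' (- t) (- t')) => //; first by rewrite -q.
  by rewrite dotNr dotNl rt1 opprK.
- apply: (C_eq0 j' t (- t')) => //; first by rewrite -q.
  by rewrite dotNr tt'.
- apply: (C_eq0 i' (- t) t') => //; first by rewrite -q.
  by rewrite dotNl tt'.
Qed.

(** * Faces and corners of the dual cone *)
Lemma dualcD x y : dualc x -> dualc y -> dualc (x + y).
Proof. by move=> hx hy z pz; rewrite dotDl addr_ge0 ?hx ?hy. Qed.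

Lemma dualcZ (a : R) x : 0 <= a -> dualc x -> dualc (a *: x).
Proof. by move=> a0 hx z pz; rewrite dotZl mulr_ge0 ?hx. Qed.

Lemma dualc_ray u g (a b : R) : 0 <= a -> a <= b -> dualc u -> dualc (u + b *: g) ->
  dualc (u + a *: g).
Proof.
move=> a0 ab du dg; have [b0|b0] := eqVneq b 0.
  by have -> : a = b by lra.
have bp : 0 < b by rewrite lt_neqAle eq_sym b0; lra.
have -> : u + a *: g = (1 - a / b) *: u + (a / b) *: (u + b *: g).
  rewrite scalerDr scalerA divfK // addrA -scalerDl; congr (_ + _).
  by rewrite subrK scale1r.
by apply: dualcD; apply: dualcZ => //; rewrite ?subr_ge0 ?ler_pdivrMr ?mul1r // divr_ge0 // ltW.
Qed.

(** Every vector of [posc] pairs with [d l] to at least [eps] times its norm, which pays for the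
    perturbation [g]. *)
Lemma dualc_interior u g (a : R) : dualc u -> enorm g <= a * eps -> dualc (u + g + a *: d l).
Proof.
move=> du hg x px; rewrite !dotDl dotZl -addrA addr_ge0 ?du //.
have := cauchy_schwarz g x; rewrite ler_norml => /andP[h _].
have := posc_d x px => h'.
have nx := enorm_ge0 x; have := ler_wpM2r nx hg.
have a0 : 0 <= a.
  by rewrite -(ler_pM2r eps0) mul0r; apply: le_trans hg; exact: enorm_ge0.
have := ler_wpM2l a0 h'; lra.
Qed.

Lemma dualc_lt x : ~ dualc x -> exists2 z, posc z & dot x z < 0.
Proof.
move=> /existsNP[z /not_implyP[pz h]]; exists z => //.
by rewrite ltNge; apply/negP.
Qed.

Lemma d_le x : dot (d l) x <= enorm x.
Proof. by have := dot_le_enorm (d l) x; rewrite (enorm1 _ (d1 l)) mul1r. Qed.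

(** [b] is the infimum of the parameters inside the closed cone. A uniform lower bound [k] for the
    pairings at [b] would allow a step back by [Num.min k b], since [dot (d l) x <= enorm x]. *)
Lemma dualc_exit y (a : R) : ~ dualc y -> 0 <= a -> dualc (y + a *: d l) ->
  exists b, [/\ 0 < b, b <= a, dualc (y + b *: d l) &
    forall k, 0 < k -> exists2 x, posc x & dot (y + b *: d l) x < k * enorm x].
Proof.
move=> ny a0 ya; pose A := [set b | 0 <= b /\ dualc (y + b *: d l)].
have lA : lbound A 0 by move=> b [].
have iA : has_inf A by split; [exists a|exists 0].
pose b := inf A.
have b0 : 0 <= b by apply: lb_le_inf => //; exists a.
have db : dualc (y + b *: d l).
  move=> x px; rewrite leNgt; apply/negP => h.
  have xn : 0 < enorm x by rewrite enorm_gt0; case: px => /c_neq0.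
  have e0 : 0 < - dot (y + b *: d l) x / enorm x by rewrite divr_gt0 // oppr_gt0.
  have [b' Ab' hb'] := inf_adherent e0 iA; have [b'0 /(_ x px) hbx] := Ab'.
  rewrite -/b -ltrBlDl ltr_pdivlMr // in hb'.
  have := d_le x; move: hb' hbx h; rewrite !dotDl !dotZl => h1 h2 h3 h4.
  have bb : b <= b' by apply: ge_inf => //; exists 0.
  have : (b' - b) * dot (d l) x <= (b' - b) * enorm x by rewrite ler_wpM2l // subr_ge0.
  lra.
have bn0 : b != 0.
  by apply/eqP => b00; apply: ny; rewrite b00 scale0r addr0 in db.
have bp : 0 < b by rewrite lt_neqAle eq_sym bn0.
exists b; split=> //; first by apply: ge_inf; [exists 0|split].
move=> k k0; apply: contrapT => H.
pose k' := Num.min k b.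
have [k1 k2] : k' <= k /\ k' <= b by rewrite !ge_min !lexx orbT.
have k'0 : 0 < k' by rewrite lt_min k0.
have : A (b - k').
  split; first by rewrite subr_ge0.
  move=> x px; have : k * enorm x <= dot (y + b *: d l) x.
    by rewrite leNgt; apply/negP => h; apply: H; exists x.
  have := d_le x; have := enorm_ge0 x; rewrite !dotDl !dotZl => h1 h2 h3.
  have : k' * dot (d l) x <= k' * enorm x by rewrite ler_pM2l.
  have : k' * enorm x <= k * enorm x by rewrite ler_wpM2r.
  lra.
move=> Ab; have : b <= b - k' by apply: ge_inf => //; exists 0.
lra.
Qed.

Lemma bdry_unitv w : w != 0 -> dualc w ->
  (forall k, 0 < k -> exists2 x, posc x & dot w x < k * enorm x) -> bdry (unitv w).
Proof.
move=> w0 dw h; have nw : 0 < enorm w by rewrite enorm_gt0.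
split; first exact: dot_unitv; first by apply: dualcZ => //; rewrite invr_ge0 ltW.
move=> k k0; have [x px hx] := h _ (mulr_gt0 nw k0); exists x => //.
by rewrite dotZl ltr_pdivrMl // mulrA.
Qed.

Definition normal r := (forall y, dualc y -> 0 <= dot y r) /\ 0 < dot (d l) r.

Lemma edge_normal v r t i j : edge v r t i j -> normal r.
Proof.
move=> e; split=> [y dy|]; first exact: edge_dual e dy.
exact: lt_le_trans eps0 (edge_center _ _ _ _ _ e).
Qed.

(** An interior point could be moved by [- k *: d l] inside the cone, but this makes its product
    with [r] negative. *)
Lemma bdry_perp v r : normal r -> dot v v = 1 -> dualc v -> dot v r = 0 -> bdry v.
Proof.
move=> [rd dr] vv dv vr; split=> // k k0; apply: contrapT => H.
have : dualc (v - k *: d l).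
  move=> x px; have : k * enorm x <= dot v x.
    by rewrite leNgt; apply/negP => h; apply: H; exists x.
  have := d_le x; rewrite dotDl dotNl dotZl => h1 h2.
  have : k * dot (d l) x <= k * enorm x by rewrite ler_pM2l.
  lra.
by move=> /rd; rewrite dotDl dotNl dotZl vr; nra.
Qed.

(** Pushing [v + a *: g] back along [d l] gives boundary points [v1] near [v] whose normals are
    obtuse to [g]. A limit [r'] of these normals is a normal at [v], and rigidity makes a nearby
    [r1] equal to it. So [r'] differs from [r], is orthogonal to [r] and [v], and equals [- g]. Then
    [v1], orthogonal to [r1 = - g], lies in the plane of [v] and [r], which puts some [v + a *: r]
    in the cone. *)
Lemma edge_end v r t i j g (a0 : R) : edge v r t i j -> dualc v -> dot g g = 1 ->
  dot v g = 0 -> dot r g = 0 -> 0 < a0 -> (forall a, 0 < a -> a < a0 -> ~ dualc (v + a *: g)) ->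
  exists t' i' j' a, [/\ edge v (- g) t' i' j', 0 < a & dualc (v + a *: r)].
Proof.
move=> ev dv gg vg rg a00 ng.
have [vv tt rr [vt vr tr]] := edge_ortho _ _ _ _ _ ev.
have nr := edge_normal _ _ _ _ _ ev.
have ie : 0 < eps^-1 by rewrite invr_gt0.
pose Q eta r1 t1 (k : 'I_4 * 'I_4) := exists v1, [/\ enorm (v1 - v) < eta,
  edge v1 r1 t1 k.1 k.2, dualc v1, dot g r1 < 0 & 0 < dot v1 r].
have [eta eta' u w k ee|eta e0|r' [t' [k [rr' tt' hk]]]] := cluster_unit2 _ Q.
- by move=> [v1 [h1 h2 h3 h4 h5]]; exists v1; split=> //; exact: lt_le_trans ee.
(* Re-entering the cone along [d l] costs at most [a / eps], so the total displacement is at most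
   [a * K]. *)
- pose K := 1 + eps^-1; have K0 : 1 < K by rewrite /K; lra.
  pose a := Num.min (a0 / 2) (Num.min (eta / (4 * K)) (1 / (4 * K))).
  have a_gt0 : 0 < a by rewrite !lt_min !divr_gt0 ?mulr_gt0 //; lra.
  have [a1 a2 a3] : [/\ a <= a0 / 2, a <= eta / (4 * K) & a <= 1 / (4 * K)].
    by split; rewrite !ge_min lexx ?orbT.
  rewrite !ler_pdivlMr in a2 a3; [|by rewrite mulr_gt0 //; lra|by rewrite mulr_gt0 //; lra].
  have nya : ~ dualc (v + a *: g) by apply: ng => //; lra.
  have dya : dualc (v + a *: g + (a * eps^-1) *: d l).
    apply: dualc_interior => //; rewrite enormZ (enorm1 _ gg) mulr1 gtr0_norm //.
    by rewrite divfK // gt_eqF.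
  have [|b [b0 ba dw bw]] := dualc_exit _ _ nya _ dya; first by rewrite mulr_ge0 // ltW.
  set w := _ + b *: _ in dw bw.
  have wv : enorm (w - v) <= a * K.
    have -> : w - v = a *: g + b *: d l by rewrite /w addrC !addrA addNr add0r.
    apply: le_trans (enormD _ _) _; rewrite !enormZ (enorm1 _ gg) (enorm1 _ (d1 l)).
    by rewrite !gtr0_norm // /K; lra.
  have w0 : w != 0.
    apply/eqP => w00; move: wv; rewrite w00 sub0r enormN (enorm1 _ vv); lra.
  have [r1 [t1 [i1 [j1 e1]]]] := edge_exists _ (bdry_unitv w w0 dw bw).
  have [_ tt1 rr1 [_ vr1 _]] := edge_ortho _ _ _ _ _ e1.
  have nw : 0 < enorm w by rewrite enorm_gt0.
  exists r1, t1, (i1, j1); split=> //; exists (unitv w); split=> //.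
  + have := enorm_dist (unitv w) w v; rewrite (unitv_dist _ w0).
    have := enormBB v w; rewrite (enorm1 _ vv) (enormB v w); lra.
  + by apply: dualcZ => //; rewrite invr_ge0 ltW.
  + have wr1 : dot w r1 = 0 by rewrite -(unitvK w w0) dotZl vr1 mulr0.
    have [n1 n2] := edge_normal _ _ _ _ _ e1; have := n1 v dv.
    move: wr1; rewrite /w !dotDl !dotZl => h1 h2.
    have h3 : 0 < b * dot (d l) r1 by rewrite mulr_gt0.
    by rewrite -(pmulr_rlt0 _ a_gt0); lra.
  + rewrite /unitv dotZl mulr_gt0 ?invr_gt0 // /w !dotDl !dotZl vr (dotC g) rg.
    by rewrite mulr0 !add0r mulr_gt0 //; case: nr.
have ev' : edge v r' t' k.1 k.2.
  apply: edge_lim => eta /hk[r1 [t1 [_ _ h1 h2 [v1 [h3 h4 _ _ _]]]]].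
  by exists v1, r1, t1.
have [_ _ _ [_ vr' _]] := edge_ortho _ _ _ _ _ ev'.
have h2 : 0 < 1 / 2 :> R by lra.
have [r1 [t1 [rr1 _ c1 _ [v1 [c2 e1 dv1 gr1 vr1]]]]] := hk _ h2.
have close : r1 = r'.
  have p1 : 0 < dot r' r1 by have := dot_close _ _ rr' c1; lra.
  have p2 : 0 < dot v v1 by have := dot_close _ _ vv c2; lra.
  exact: edge_rigid ev' e1 dv dv1 p1 p2.
have r'r : r' != r.
  by apply: contraTneq gr1; rewrite close => ->; rewrite dotC rg ltxx.
have rr'0 := edge_corner _ _ _ _ _ _ _ _ _ ev ev' r'r.
have o : ortho3 v g r by split=> //; split=> //; rewrite dotC.
have E := ortho3_exp _ _ _ r' o.
rewrite (dotC r' v) vr' (dotC r' r) rr'0 !scale0r add0r addr0 in E.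
have gm : dot r' g = -1.
  have : dot r' g ^+ 2 = 1 by rewrite -rr' {2 3}E !dotL gg mulr1 expr2.
  move=> /eqP; rewrite sqrf_eq1 => /orP[]/eqP // h.
  by move: gr1; rewrite close dotC h ltNge ler01.
rewrite gm scaleN1r in E.
have v1g : dot v1 g = 0.
  have [_ _ _ [_ h _]] := edge_ortho _ _ _ _ _ e1.
  by move: h; rewrite close E dotNr => /eqP; rewrite oppr_eq0 => /eqP.
have E1 := ortho3_exp _ _ _ v1 o; rewrite v1g scale0r addr0 in E1.
have vv1 : 0 < dot v1 v by rewrite dotC; have := dot_close _ _ vv c2; lra.
rewrite E in ev'; exists t', k.1, k.2, (dot v1 r / dot v1 v); split=> //; first exact: divr_gt0.
have -> : v + (dot v1 r / dot v1 v) *: r = (dot v1 v)^-1 *: v1.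
  by rewrite {4}E1 scalerDr !scalerA mulVf ?gt_eqF // scale1r mulrC.
by apply: dualcZ => //; rewrite invr_ge0 ltW.
Qed.

(* [turn1 e f a] and [turn2 e f a] are [e] and [f] rotated by [atan a]. *)
Definition turn1 (e f : 'rV[R]_3) (a : R) := (Num.sqrt (1 + a ^+ 2))^-1 *: (e + a *: f).
Definition turn2 (e f : 'rV[R]_3) (a : R) := (Num.sqrt (1 + a ^+ 2))^-1 *: (f - a *: e).

Lemma sqrt1D_gt0 (a : R) : 0 < Num.sqrt (1 + a ^+ 2).
Proof. by rewrite sqrtr_gt0 ltr_wpDr // sqr_ge0. Qed.

Lemma turn_ortho e f n a : ortho3 e f n -> ortho3 (turn1 e f a) (turn2 e f a) n.
Proof. exact: ortho3_turn. Qed.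

Lemma turn1_unitv e f n a : ortho3 e f n -> turn1 e f a = unitv (e + a *: f).
Proof. by move=> o; rewrite /unitv (enorm_turn _ _ _ _ o). Qed.

Lemma dualc_turn1 e f a : dualc (e + a *: f) -> dualc (turn1 e f a).
Proof. by apply: dualcZ; rewrite invr_ge0 ltW // sqrt1D_gt0. Qed.

(** A normal at an inner point of the segment from [e] to [e + b *: f] is nonnegative at both ends
    and zero in between, hence zero on the segment and equal to [n]. The sign of the tangent is
    absorbed by [edge_turn]. *)
Lemma mid_edge e f n (a b : R) : ortho3 e f n -> normal n -> dualc e -> dualc (e + b *: f) ->
  0 < a -> a < b -> exists i j, edge (turn1 e f a) n (turn2 e f a) i j.
Proof.
move=> o nn de db a0 ab.
have [vv tt nn1 [vt vn tn]] := turn_ortho e f n a o.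
have [ee ff _ [ef en fn]] := o.
have da : dualc (e + a *: f) by apply: (dualc_ray _ _ a b) => //; exact: ltW.
have bv := bdry_perp _ _ nn vv (dualc_turn1 _ _ _ da) vn.
have [r [t [i [j ed]]]] := edge_exists _ bv.
have [_ tt1 rr [vt1 vr tr]] := edge_ortho _ _ _ _ _ ed.
have [rd rc] := edge_normal _ _ _ _ _ ed.
have h1 := rd _ de; have h2 := rd _ db; rewrite dotDl dotZl in h2.
have h3 : dot e r + a * dot f r = 0.
  move/eqP: vr; rewrite /turn1 dotZl mulf_eq0 invr_eq0 gt_eqF ?sqrt1D_gt0 //= dotDl dotZl.
  by move/eqP.
have fr : dot f r = 0.
  have [h|h|//] := ltrgtP (dot f r) 0; exfalso; nra.
have er : dot e r = 0 by rewrite fr mulr0 addr0 in h3.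
have E := ortho3_exp _ _ _ r o.
rewrite (dotC r e) er (dotC r f) fr !scale0r !add0r in E.
have rn : r = n.
  have : dot r n ^+ 2 = 1 by rewrite -rr {2 3}E !dotL nn1 mulr1 expr2.
  move=> /eqP; rewrite sqrf_eq1 => /orP[]/eqP h; first by rewrite E h scale1r.
  move: rc; rewrite E h scaleN1r dotNr oppr_gt0 ltNge ltW //.
  by case: nn.
rewrite rn in ed vr tr.
have o' := turn_ortho e f n a o.
have T := ortho3_exp _ _ _ t o'.
rewrite (dotC t _) vt1 tr !scale0r add0r addr0 in T.
have : dot t (turn2 e f a) ^+ 2 = 1 by rewrite -tt1 {2 3}T (dotZl _ (turn2 e f a)) (dotZr _ (turn2 e f a)) tt mulr1 expr2.
move=> /eqP; rewrite sqrf_eq1 => /orP[]/eqP h.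
  by exists i, j; rewrite -[turn2 e f a]scale1r -h -T.
exists j, i; rewrite -[turn2 e f a]opprK -[- turn2 _ _ _]scaleN1r -h -T.
exact: edge_turn.
Qed.

(** The end of the segment may be a corner with further normals; [n] is one of them, as the limit of
    the edges at inner points. *)
Lemma edge_at_end e f n (b : R) : ortho3 e f n -> normal n -> dualc e -> dualc (e + b *: f) ->
  0 < b -> exists t i j, edge (turn1 e f b) n t i j.
Proof.
move=> o nn de db b0.
pose Q eta t (k : 'I_4 * 'I_4) := exists v1, enorm (v1 - turn1 e f b) < eta /\ edge v1 n t k.1 k.2.
have [eta eta' u k ee [v1 [h1 h2]]|eta e0|t [k [tt hk]]] := cluster_unit _ Q.
- by exists v1; split=> //; exact: lt_le_trans ee.
- pose h := Num.min (b / 2) (eta / 3).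
  have h0 : 0 < h by rewrite lt_min !divr_gt0.
  have [h1 h2] : h <= b / 2 /\ h <= eta / 3 by rewrite !ge_min !lexx orbT.
  have a0 : 0 < b - h by lra.
  have ab : b - h < b by lra.
  have [i [j ed]] := mid_edge e f n (b - h) b o nn de db a0 ab.
  have [_ tt _ _] := edge_ortho _ _ _ _ _ ed.
  have [_ ff _ _] := o.
  exists (turn2 e f (b - h)), (i, j); split=> //; exists (turn1 e f (b - h)); split=> //.
  rewrite !(turn1_unitv _ _ _ _ o).
  have n0 : e + (b - h) *: f != 0 by rewrite -enorm_gt0 (enorm_turn _ _ _ _ o) sqrt1D_gt0.
  have n1 : 1 <= enorm (e + b *: f).
    by rewrite (enorm_turn _ _ _ _ o) -[leLHS]sqrtr1 ler_sqrt // ?lerDl ?sqr_ge0 // addr_ge0 // sqr_ge0.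
  apply: le_lt_trans (unitv_lip _ _ n0 n1) _.
  have -> : e + (b - h) *: f - (e + b *: f) = (- h) *: f.
    by apply/rowP => m; rewrite !mxE; ring.
  by rewrite enormZ (enorm1 _ ff) mulr1 normrN gtr0_norm //; lra.
exists t, k.1, k.2; apply: edge_lim => eta e0.
have [t1 [tt1 h1 [v1 [h2 h3]]]] := hk _ e0.
exists v1, n, t1; split=> //; first by rewrite subrr /enorm dot0l sqrtr0.
Qed.

(** By the addition formula for tangents, [turn1 e f b + a *: turn2 e f b] is a positive multiple of
    a vector [e + a' *: f] with [a' > b]; the bound [a < (1 + b)^-1] keeps the denominator
    [1 - a * b] positive. So [turn2 e f b] leaves the cone at once. *)
Lemma ray_corner e f n (b : R) t i j : ortho3 e f n -> dualc (e + b *: f) -> 0 <= b ->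
  (forall a, b < a -> ~ dualc (e + a *: f)) -> edge (turn1 e f b) n t i j ->
  exists t' i' j' a, [/\ edge (turn1 e f b) (- turn2 e f b) t' i' j', 0 < a &
    dualc (turn1 e f b + a *: n)].
Proof.
move=> o db b0 nb ed.
have [vv tt _ [vt vn tn]] := turn_ortho e f n b o.
have b1 : 0 < (1 + b)^-1 by rewrite invr_gt0; lra.
apply: (edge_end _ _ _ _ _ _ _ ed _ tt vt _ b1) => //.
- exact: dualc_turn1.
- by rewrite dotC.
move=> a a0 a1 H.
have s0 := sqrt1D_gt0 b; set m := Num.sqrt _ in s0.
have q0 : 0 < 1 - a * b.
  have : a * (1 + b) < 1 by rewrite -ltr_pdivlMr ?mul1r //; lra.
  lra.
apply: (nb ((b + a) / (1 - a * b))); first by rewrite ltr_pdivlMr //; nra.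
have -> : e + ((b + a) / (1 - a * b)) *: f = (m / (1 - a * b)) *: (turn1 e f b + a *: turn2 e f b).
  rewrite /turn1 /turn2 -/m; apply/rowP => k; rewrite !mxE; field.
  by rewrite !gt_eqF.
by apply: dualcZ H; rewrite divr_ge0 // ltW.
Qed.

Lemma ray_exit u g : dualc u -> ~ dualc g -> exists b, [/\ 0 <= b, dualc (u + b *: g) &
  forall a, b < a -> ~ dualc (u + a *: g)].
Proof.
move=> du /dualc_lt[x px gx].
pose A := [set a | 0 <= a /\ dualc (u + a *: g)].
have A0 : A 0 by split=> //; rewrite scale0r addr0.
have uA : ubound A (dot u x / - dot g x).
  move=> a [a0 /(_ x px)]; rewrite dotDl dotZl ler_pdivlMr ?oppr_gt0 //; lra.
have sA : has_sup A by split; [exists 0|exists (dot u x / - dot g x)].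
have b0 : 0 <= sup A by apply: ub_le_sup => //; case: sA.
exists (sup A); split=> // [z pz|a ha da].
  rewrite leNgt; apply/negP => h.
  have gz : dot g z < 0.
    have := du z pz; move: h; rewrite dotDl dotZl; nra.
  have e0 : 0 < - dot (u + sup A *: g) z / - dot g z by rewrite divr_gt0 ?oppr_gt0.
  have [b' [b'0 /(_ z pz) hb] hb'] := sup_adherent e0 sA.
  rewrite ltrBlDr -ltrBlDl ltr_pdivlMr ?oppr_gt0 // in hb'.
  move: hb hb'; rewrite !dotDl !dotZl; lra.
have : a <= sup A by apply: ub_le_sup; [case: sA|split=> //; lra].
lra.
Qed.

(** Otherwise the edge leaving [v] along [r'] ends at a corner [v2] short of [r']. Three edges are
    compared: the one from [v] to [v2], with normal [r], and those leaving [v] and [v2] along [r],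
    with normals [r'] and [- g]. The sign rule keeps the arcs towards [- T2] and [- T3] off both
    colors of the first edge; only three colors being available, these arcs share a color, which the
    sign rule forbids as well. *)
Lemma corner_dual v r t i j r' t' i' j' (a a' : R) :
  edge v r t i j -> edge v r' t' i' j' -> dualc v -> dot r r' = 0 ->
  0 < a -> dualc (v + a *: r) -> 0 < a' -> dualc (v + a' *: r') -> dualc r'.
Proof.
move=> e e' dv rr' a0 da a'0 da'; apply: contrapT => nr'.
have [vv _ rr [_ vr _]] := edge_ortho _ _ _ _ _ e.
have [_ _ rr1 [_ vr1 _]] := edge_ortho _ _ _ _ _ e'.
have n1 := edge_normal _ _ _ _ _ e; have n2 := edge_normal _ _ _ _ _ e'.
have [b [b0 db nb]] := ray_exit v r' dv nr'.
have bp : 0 < b.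
  rewrite lt_neqAle b0 andbT eq_sym; apply/eqP => b00.
  by apply: (nb a') => //; rewrite b00.
have o1 : ortho3 v r' r by split=> //; split=> //; rewrite dotC.
have o2 : ortho3 v r r' by split.
have [t2 [i2 [j2 e2]]] := edge_at_end _ _ _ _ o1 n1 dv db bp.
have [t3 [i3 [j3 [a3 [e3 a30 da3]]]]] := ray_corner _ _ _ _ _ _ _ o1 db b0 nb e2.
have n3 := edge_normal _ _ _ _ _ e3.
have [vv2 gg _ [vg vn gn]] := turn_ortho _ _ _ b o1.
have [v2 v2E] : exists v2, v2 = turn1 v r' b by eexists.
have [g gE] : exists g, g = turn2 v r' b by eexists.
rewrite -gE -v2E in e3 n3 da3 vv2 gg vg vn gn.
have dv2 : dualc v2 by rewrite v2E; exact: dualc_turn1.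
have o3 : ortho3 v2 r (- g).
  split=> //; first by rewrite dotNl dotNr opprK.
  by split; rewrite // dotNr ?vg ?(dotC r) ?gn oppr0.
have hb2 : 0 < b / 2 by lra.
have hb : b / 2 < b by lra.
have ha2 : 0 < a / 2 by lra.
have ha : a / 2 < a by lra.
have h32 : 0 < a3 / 2 by lra.
have h3 : a3 / 2 < a3 by lra.
have [A [A' E1]] := mid_edge _ _ _ (b / 2) b o1 n1 dv db hb2 hb.
have [B [B' E2]] := mid_edge _ _ _ (a / 2) a o2 n2 dv da ha2 ha.
have [D [D' E3]] := mid_edge _ _ _ (a3 / 2) a3 o3 n3 dv2 da3 h32 h3.
set x := b / 2 in hb2 hb E1; set y := a / 2 in ha2 ha E2; set z := a3 / 2 in h32 h3 E3.
have [_ uu1 _ _] := edge_ortho _ _ _ _ _ E1.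
have [_ uu2 _ _] := edge_ortho _ _ _ _ _ E2.
have [_ uu3 nn3 _] := edge_ortho _ _ _ _ _ E3.
have [A1 A2 A3] := edge_colors _ _ _ _ _ E1.
have [B1 B2 B3] := edge_colors _ _ _ _ _ E2.
have [D1 D2 D3] := edge_colors _ _ _ _ _ E3.
have mx := sqrt1D_gt0 x; have my := sqrt1D_gt0 y; have mz := sqrt1D_gt0 z; have mb := sqrt1D_gt0 b.
have [T1 T1E] : exists T1, T1 = turn2 v r' x by eexists.
have [T2 T2E] : exists T2, T2 = turn2 v r y by eexists.
have [T3 T3E] : exists T3, T3 = turn2 v2 r z by eexists.
rewrite -T1E in E1 uu1; rewrite -T2E in E2 uu2; rewrite -T3E in E3 uu3.
have r'v := vr1; have rv := vr; rewrite dotC in r'v; rewrite dotC in rv.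
have r'r := rr'; rewrite dotC in r'r.
have dd := (vv, rr, rr1, vr, vr1, rv, r'v, rr', r'r).
have v2v : 0 < dot v2 v by rewrite v2E /turn1 !dotL !dd mulr0 addr0 mulr1 invr_gt0.
have v2r' : 0 < dot v2 r'.
  by rewrite v2E /turn1 !dotL !dd add0r mulr1 mulr_gt0 ?invr_gt0.
have v2r : dot v2 r = 0 by [].
have gr' : 0 < dot g r' by rewrite gE /turn2 !dotL !dd mulr0 subr0 mulr1 invr_gt0.
have gv : dot g v < 0.
  by rewrite gE /turn2 !dotL !dd sub0r mulr1 pmulr_rlt0 ?invr_gt0 // oppr_lt0.
have T1r : dot T1 r = 0 by rewrite T1E /turn2 !dotL !dd; ring.
have T1v2 : 0 < dot T1 v2.
  have -> : dot T1 v2 = (Num.sqrt (1 + x ^+ 2))^-1 * ((Num.sqrt (1 + b ^+ 2))^-1 * (b - x)).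
    by rewrite T1E v2E /turn1 /turn2 !dotL !dd; ring.
  by rewrite !mulr_gt0 ?invr_gt0 // subr_gt0.
have T1g : 0 < dot T1 g.
  have -> : dot T1 g = (Num.sqrt (1 + x ^+ 2))^-1 * ((Num.sqrt (1 + b ^+ 2))^-1 * (1 + x * b)).
    by rewrite T1E gE /turn2 !dotL !dd; ring.
  by rewrite !mulr_gt0 ?invr_gt0 // addr_gt0 // mulr_gt0.
have T1r' : 0 < dot T1 r'.
  by rewrite T1E /turn2 !dotL !dd mulr0 subr0 mulr1 invr_gt0.
have T2r : 0 < dot r T2.
  by rewrite T2E /turn2 !dotL !dd mulr0 subr0 mulr1 invr_gt0.
have T3r : 0 < dot r T3.
  by rewrite T3E /turn2 !dotL rr (dotC r v2) vn mulr0 subr0 mulr1 invr_gt0.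
have T12 : 0 < dot T1 T2.
  have -> : dot T1 T2 = (Num.sqrt (1 + x ^+ 2))^-1 * ((Num.sqrt (1 + y ^+ 2))^-1 * (x * y)).
    by rewrite T1E T2E /turn2 !dotL !dd; ring.
  by rewrite !mulr_gt0 ?invr_gt0.
have T13 : dot T1 T3 < 0.
  have -> : dot T1 T3 = - ((Num.sqrt (1 + z ^+ 2))^-1 * (z * dot T1 v2)).
    rewrite T3E /turn2 (dotZr _ (r - z *: v2)) (dotDr r) (dotNr (z *: v2)) (dotZr z) T1r; ring.
  by rewrite oppr_lt0 !mulr_gt0 ?invr_gt0.
have r'T3 : dot r' T3 < 0.
  have -> : dot r' T3 = - ((Num.sqrt (1 + z ^+ 2))^-1 * (z * dot v2 r')).
    rewrite (dotC v2) T3E /turn2 (dotZr _ (r - z *: v2)) (dotDr r) (dotNr (z *: v2)) (dotZr z) r'r; ring.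
  by rewrite oppr_lt0 !mulr_gt0 ?invr_gt0.
have unitN (w : 'rV[R]_3) : dot w w = 1 -> dot (- w) (- w) = 1 by rewrite dotNl dotNr opprK.
have K := conicl; have L := conicr.
have pos := edge_arc; have neg := edge_arcN.
have sign := arc_sign.
have AB' : A <> B'.
  move=> q; have arcB := neg _ _ _ _ _ E2; rewrite -q in arcB.
  apply: (sign _ _ _ _ A rr uu1 rr1 (unitN _ uu2) (pos _ _ _ _ _ E1) arcB T1 r' r (- T2)) => //.
  by rewrite dotNr oppr_lt0.
have A'B' : A' <> B'.
  move=> q; have arcB := neg _ _ _ _ _ E2; rewrite -q in arcB.
  apply: (sign _ _ _ _ A' rr (unitN _ uu1) rr1 (unitN _ uu2) (neg _ _ _ _ _ E1) arcB (- T1) (- T2) r (- T2)) => //.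
    by rewrite dotNl dotNr opprK.
  by rewrite dotNr oppr_lt0.
have AD' : A <> D'.
  move=> q; have arcD := neg _ _ _ _ _ E3; rewrite -q in arcD.
  apply: (sign _ _ _ _ A rr uu1 nn3 (unitN _ uu3) (pos _ _ _ _ _ E1) arcD T1 (- T3) r (- T3)) => //.
    by rewrite dotNr oppr_gt0.
  by rewrite dotNr oppr_lt0.
have A'D' : A' <> D'.
  move=> q; have arcD := neg _ _ _ _ _ E3; rewrite -q in arcD.
  apply: (sign _ _ _ _ A' rr (unitN _ uu1) nn3 (unitN _ uu3) (neg _ _ _ _ _ E1) arcD (- T1) (- g) r (- T3)) => //.
    by rewrite dotNl dotNr opprK.
  by rewrite dotNr oppr_lt0.
have q : B' = D'.
  apply/eqP/negPn/negP => BD'.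
  by have [] := color_pigeonhole A A' B' D' A1 A2 A3 BD' B3 D3.
have arcB := neg _ _ _ _ _ E2; rewrite q in arcB.
apply: (sign _ _ _ _ D' rr1 (unitN _ uu2) nn3 (unitN _ uu3) arcB (neg _ _ _ _ _ E3) r' (- T3) r' (- g)) => //.
  by rewrite dotNr oppr_gt0.
by rewrite dotNr oppr_lt0 dotC.
Qed.

Hypothesis c_span : forall q, q != 0 -> exists2 x, c l x & dot x q != 0.

Lemma dualc_pointed g : g != 0 -> dualc g -> ~ dualc (- g).
Proof.
move=> g0 h1 h2; have [x cx /eqP xg] := c_span g g0; apply: xg.
have z y : posc y -> dot g y = 0.
  by move=> py; have := h1 y py; have := h2 y py; rewrite dotNl; lra.
case: (poscN x cx) => /z; first by rewrite dotC.
by rewrite dotNr dotC; lra.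
Qed.

Theorem octant_frame : exists e f n, [/\ ortho3 e f n, dualc e, dualc f & dualc n].
Proof.
have unit0 (w : 'rV[R]_3) : dot w w = 1 -> w != 0.
  by move=> h; rewrite -dotxx_gt0 h ltr01.
have [v [r [t [i [j [ev dv]]]]]] : exists v r t i j, edge v r t i j /\ dualc v.
  have [z0 [z1 [_ z00 _ [dz0 _ _]]]] := ortho3_extend (d l) (d1 l).
  have [z [zz dz nz]] : exists z, [/\ dot z z = 1, dot (d l) z = 0 & ~ dualc z].
    have [h|h] := pselect (dualc z0); last by exists z0.
    exists (- z0); split; first by rewrite dotNl dotNr opprK.
      by rewrite dotNr dz0 oppr0.
    exact: dualc_pointed (unit0 _ z00) h.
  have ie : 0 < eps^-1 by rewrite invr_gt0.
  have [] := dualc_exit z eps^-1 nz (ltW ie).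
    rewrite -[z]add0r; apply: dualc_interior.
      by move=> x _; rewrite dot0l.
    by rewrite mulVf ?gt_eqF // (enorm1 _ zz).
  move=> b [b0 _ dw bw].
  have w0 : z + b *: d l != 0.
    by apply: (@dot_neq0l _ _ z); rewrite dotDl dotZl dz zz mulr0 addr0 oner_eq0.
  have bv := bdry_unitv _ w0 dw bw.
  have [r [t [i [j ed]]]] := edge_exists _ bv.
  by exists (unitv (z + b *: d l)), r, t, i, j; split=> //; case: bv.
(* The cone is pointed, so one of [t] and [- t] lies outside it and can be followed to a corner. *)
wlog nt : t i j ev / ~ dualc t.
  move=> W; have [h|h] := pselect (dualc t); last exact: W ev h.
  apply: (W (- t) j i) => //; first exact: edge_turn.
  by apply: dualc_pointed h; apply: unit0; case: (edge_ortho _ _ _ _ _ ev).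
have o := edge_ortho _ _ _ _ _ ev.
have nr := edge_normal _ _ _ _ _ ev.
have [b [b0 db nb]] := ray_exit v t dv nt.
have [t2 [i2 [j2 e2]]] : exists t' i' j', edge (turn1 v t b) r t' i' j'.
  have [b00|bn0] := eqVneq b 0; last first.
    by apply: edge_at_end o nr dv db _; rewrite lt_neqAle eq_sym bn0.
  exists t, i, j; rewrite /turn1 b00 expr0n addr0 sqrtr1 invr1 scale1r scale0r addr0.
  exact: ev.
have [t3 [i3 [j3 [a [e3 a0 da]]]]] := ray_corner _ _ _ _ _ _ _ o db b0 nb e2.
have [vv2 gg rr [vg vn gn]] := turn_ortho _ _ _ b o.
have dv2 := dualc_turn1 _ _ _ db.
move: e2 e3 da vv2 gg vg vn gn dv2.
move: (turn1 v t b) (turn2 v t b) => v2 g e2 e3 da vv2 gg vg vn gn dv2.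
have rr' : dot r (- g) = 0 by rewrite dotNr dotC gn oppr0.
(* The same corner seen from its other edge: moving along [- r] leaves the cone at once because [r]
   is a normal, and this provides the edge in direction [- g]. *)
have [t4 [i4 [j4 [a' [_ a'0 da']]]]] :
    exists t' i' j' a, [/\ edge v2 (- - r) t' i' j', 0 < a & dualc (v2 + a *: - g)].
  apply: (edge_end _ _ _ _ _ (- r) 1 e3 dv2).
  - by rewrite dotNl dotNr opprK.
  - by rewrite dotNr vn oppr0.
  - by rewrite dotNl dotNr gn !oppr0.
  - exact: ltr01.
  move=> x x0 _ /(proj1 nr); rewrite dotDl dotZl dotNl vn rr; lra.
exists v2, (- g), r; split=> //.
- split=> //; first by rewrite dotNl dotNr opprK.
  by split; rewrite ?dotNr ?dotNl ?vg ?gn ?oppr0.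
- exact: corner_dual e2 e3 dv2 rr' a0 da a'0 da'.
- by apply: corner_dual e3 e2 dv2 _ a'0 da' a0 da; rewrite dotC.
Qed.

End Coloring.

(** * Dominated color classes *)
Section Dominating.
Context {R : realType}.
Implicit Types (u v w x y z e f n q : 'rV[R]_3).

Definition octant e f n x :=
  [/\ 0 <= dot x e, 0 <= dot x f & 0 <= dot x n] \/
  [/\ dot x e <= 0, dot x f <= 0 & dot x n <= 0].

Lemma dominates_ball D (S : set 'rV[R]_3) : dominates D S -> exists d0 del,
  [/\ dot d0 d0 = 1, 0 < del &
  forall n u, n != 0 -> dot u u = 1 -> enorm (u - d0) < del -> dot n u = 0 ->
    exists2 y, S y & dot n y = 0].
Proof.
move=> [[d0 Dd0] Ds Do H].
have /open_subspaceP[V oV VD] := Do.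
have Vd0 : V d0.
  have : (D `&` @sphere R) d0 by split=> //; exact: Ds.
  by rewrite -VD => -[].
have [del del0 hdel] := nbhs_enormP _ _ (open_nbhs_nbhs (conj oV Vd0)).
exists d0, del; split=> //; first exact: Ds Dd0.
move=> n u n0 uu hu nu.
have Du : D u.
  have : (V `&` @sphere R) u by split=> //; exact: hdel.
  by rewrite VD => -[].
have [||y [[_ hy] Sy]] := H (@sphere R `&` [set x | dot n x = 0]).
- by exists n.
- by exists u.
by exists y.
Qed.

Lemma ball_perp d0 x (a : R) : dot d0 d0 = 1 -> dot x x = 1 -> 0 < a -> a <= 1 / 2 ->
  `|dot d0 x| < a -> exists u, [/\ dot u u = 1, dot x u = 0 & enorm (u - d0) < 2 * a].
Proof.
move=> dd xx a0 a1 h; pose w := d0 - dot d0 x *: x.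
have hw : enorm (w - d0) = `|dot d0 x|.
  by rewrite /w addrC addKr -scaleNr enormZ normrN (enorm1 _ xx) mulr1.
have := enormBB w d0; rewrite (enorm1 _ dd) hw => h1.
have w0 : w != 0.
  apply/eqP => w0; move: h1; rewrite w0 /enorm dot0l sqrtr0 sub0r normrN normr1; lra.
exists (unitv w); split; first exact: dot_unitv.
  by rewrite /unitv dotZr /w dotDr dotNr dotZr xx mulr1 dotC subrr mulr0.
have := enorm_dist (unitv w) w d0; rewrite (unitv_dist _ w0) distrC hw; lra.
Qed.

Definition line_color (S : 'I_4 -> set 'rV[R]_3) i x := exists2 a : R, a != 0 & S i (a *: x).

Section Coloring.
Context (S : 'I_4 -> set 'rV[R]_3).
Hypothesis hS : orthogonal_coloring S.

Lemma coloring_cover x : dot x x = 1 -> exists i, S i x.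
Proof.
move=> xx; case: hS => -[cov _ _] _; have : cover setT S x by rewrite cov.
by move=> [i _ h]; exists i.
Qed.

Lemma coloring_sphere i x : S i x -> dot x x = 1.
Proof.
move=> Sx; case: hS => -[cov _ _] _; have : cover setT S x by exists i.
by rewrite cov.
Qed.

Lemma line_color_cover x : x != 0 -> exists i, line_color S i x.
Proof.
move=> x0; have [i Si] := coloring_cover _ (dot_unitv x x0).
by exists i, (enorm x)^-1 => //; rewrite invr_eq0 gt_eqF // enorm_gt0.
Qed.

Lemma line_colorZ i (a : R) x : a != 0 -> line_color S i x -> line_color S i (a *: x).
Proof.
move=> a0 [b b0 Sb]; exists (b / a); first by rewrite mulf_neq0 // invr_eq0.
by rewrite scalerA divfK.
Qed.

Lemma line_color_orth i x y : line_color S i x -> line_color S i y -> dot x y != 0.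
Proof.
move=> [a a0 Sa] [b b0 Sb]; case: hS => _ /(_ i _ _ Sa Sb).
by rewrite dotZl dotZr mulrA mulf_eq0 negb_or => /andP[].
Qed.

Lemma color_line_color i x : S i x -> line_color S i x.
Proof. by exists 1; rewrite ?oner_eq0 ?scale1r. Qed.

(** If [x] has color [i] and is almost orthogonal to [d0], the great circle orthogonal to [x] passes
    near [d0], so it meets the class in a point orthogonal to [x]. *)
Lemma dominates_center D i : dominates D (S i) -> exists d0 (a : R), [/\ dot d0 d0 = 1, 0 < a &
  forall x, line_color S i x -> a * enorm x <= `|dot d0 x|].
Proof.
move=> /dominates_ball[d0 [del [dd del0 H]]].
pose a := Num.min (1 / 2) (del / 2).
have a0 : 0 < a by rewrite lt_min !divr_gt0.
have [a1 a2] : a <= 1 / 2 /\ a <= del / 2 by rewrite !ge_min !lexx orbT.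
exists d0, a; split=> // x cx; rewrite leNgt; apply/negP => h.
have x0 : x != 0 by apply: dot_neq0l (line_color_orth _ _ _ cx cx).
have nx : 0 < enorm x by rewrite enorm_gt0.
have hu : `|dot d0 (unitv x)| < a.
  by rewrite dotZr normrM gtr0_norm ?invr_gt0 // mulrC ltr_pdivrMr.
have [u [uu xu hud]] := ball_perp _ _ _ dd (dot_unitv x x0) a0 a1 hu.
have ux0 : unitv x != 0 by rewrite -dotxx_gt0 dot_unitv.
have [|y Sy xy] := H _ u ux0 uu _ xu; first by lra.
have cux : line_color S i (unitv x) by apply: line_colorZ => //; rewrite invr_eq0 gt_eqF.
by have := line_color_orth _ _ _ cux (color_line_color _ _ Sy); rewrite xy eqxx.
Qed.

(** Suppose the class lies in the plane orthogonal to [Q], and take [u] near [d0] off that plane.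
    Great circles through [u] cut the plane in every direction, so the class meets every line of it,
    in particular two orthogonal ones. *)
Lemma dominates_span D i : dominates D (S i) -> forall q, q != 0 ->
  exists2 x, line_color S i x & dot x q != 0.
Proof.
move=> /dominates_ball[d0 [del [dd del0 H]]] q q0.
have qq := dot_unitv q q0; set Q := unitv q in qq.
apply: contrapT => nex.
have flat y : S i y -> dot y Q = 0.
  move=> Sy; rewrite /Q dotZr; apply/eqP; rewrite mulf_eq0; apply/orP; right.
  by apply/negPn/negP => h; apply: nex; exists y => //; exact: color_line_color.
clearbody Q; have [u [uu hu uQ]] : exists u, [/\ dot u u = 1, enorm (u - d0) < del & dot u Q != 0].
  have [h|h] := eqVneq (dot d0 Q) 0; last first.
    by exists d0; rewrite subrr /enorm dot0l sqrtr0.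
  pose a := del / 4; have a0 : 0 < a by rewrite /a; lra.
  pose w := d0 + a *: Q.
  have ww : dot w w = 1 + a ^+ 2 by rewrite /w !dotL dd qq h (dotC Q) h; ring.
  have w0 : w != 0 by rewrite -dotxx_gt0 ww addr_gt0 // exprn_gt0.
  have hw : enorm (w - d0) = a by rewrite /w addrC addKr enormZ (enorm1 _ qq) mulr1 gtr0_norm.
  exists (unitv w); split; first exact: dot_unitv.
    have := enorm_dist (unitv w) w d0; rewrite (unitv_dist _ w0) hw.
    by have := enormBB w d0; rewrite (enorm1 _ dd) distrC hw /a; lra.
  rewrite dotZl /w dotDl dotZl qq h add0r mulr1 mulf_neq0 ?gt_eqF // invr_gt0 enorm_gt0 //.
have [z [z' o]] := ortho3_extend Q qq.
have [_ zz zz' [Qz Qz' zz0]] := o.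
have hit t : dot Q t = 0 -> dot t t = 1 -> exists2 y, S i y & dot y t = 0.
  (* The plane orthogonal to [n] contains [u], and inside the plane orthogonal to [Q] it cuts out
     the vectors orthogonal to [t]. *)
  move=> Qt tt; pose n := dot u Q *: t - dot u t *: Q.
  have nt : dot n t = dot u Q by rewrite /n !dotL tt Qt; ring.
  have n0 : n != 0 by apply: (@dot_neq0l _ _ t); rewrite nt.
  have nu : dot n u = 0 by rewrite /n !dotL (dotC t) (dotC Q u); ring.
  have [y Sy] := H n u n0 uu hu nu.
  rewrite /n !dotL (dotC Q) (flat _ Sy) mulr0 subr0 => /eqP.
  by rewrite mulf_eq0 (negPf uQ) dotC /= => /eqP; exists y.
have [y Sy yz] := hit z Qz zz; have [y' Sy' yz'] := hit z' Qz' zz'.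
have := line_color_orth _ _ _ (color_line_color _ _ Sy) (color_line_color _ _ Sy').
by rewrite (ortho3_dot _ _ _ y y' o) (flat _ Sy) yz yz' !mul0r mulr0 !addr0 eqxx.
Qed.

Lemma dominated_frame : (forall i, exists D, dominates D (S i)) ->
  forall i, exists e f n, ortho3 e f n /\ forall x, S i x ->
    octant e f n x.
Proof.
move=> dom l.
have /choice[d /choice[a ha]] : forall i, exists d0, exists a : R, [/\ dot d0 d0 = 1, 0 < a &
    forall x, line_color S i x -> a * enorm x <= `|dot d0 x|].
  by move=> i; have [D hD] := dom i; exact: dominates_center hD.
(* The windows need one [eps] for all four colors; the default value 1 of the minimum supplies
   [eps <= 1]. *)
pose eps := \big[Num.min/1]_i a i.
have eps0 : 0 < eps.
  by rewrite /eps; elim/big_rec: _ => // i x _ x0; rewrite lt_min x0; case: (ha i) => _ ->.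
have eps1 : eps <= 1 by rewrite /eps; elim/big_rec: _ => // i x _ x1; rewrite ge_min x1 orbT.
have d1 i : dot (d i) (d i) = 1 by case: (ha i).
have dP i x : line_color S i x -> eps * enorm x <= `|dot (d i) x|.
  case: (ha i) => _ _ h /h; apply: le_trans; rewrite ler_wpM2r ?enorm_ge0 //.
  by rewrite /eps (bigD1 i) //= ge_min lexx.
have [D hD] := dom l.
have [e [f [n [o de df dn]]]] := octant_frame (line_color S) line_color_cover line_colorZ
  line_color_orth d eps eps0 eps1 d1 dP l (dominates_span _ _ hD).
exists e, f, n; split=> // x /color_line_color cx.
have [px|px] := poscN _ line_colorZ line_color_orth d eps eps0 dP l x cx.
  by left; split; rewrite dotC; [exact: de|exact: df|exact: dn].
by right; split; rewrite -oppr_ge0 dotC -dotNr; [exact: de|exact: df|exact: dn].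
Qed.

End Coloring.
End Dominating.

(** * Octahedral color classes *)
Section Octahedra.
Context {R : realType}.
Implicit Types (u v w x y z e f n g p q : 'rV[R]_3).

Lemma convex_setP (A : set 'rV[R]_3) : @convex_set R 'rV[R]_3 A <->
  forall x y (a : R), 0 <= a -> a <= 1 -> A x -> A y -> A (a *: x + (1 - a) *: y).
Proof.
split=> [h x y a a0 a1 Ax Ay|h x y k /set_mem Ax /set_mem Ay].
  by have := h x y (Itv01 a0 a1) (mem_set Ax) (mem_set Ay) => /set_mem.
by apply/mem_set; apply: h.
Qed.

Lemma convex_hull_min (A B : set 'rV[R]_3) :
  (forall x y (a : R), 0 <= a -> a <= 1 -> B x -> B y -> B (a *: x + (1 - a) *: y)) ->
  A `<=` B -> convex_hull A `<=` B.
Proof. by move=> /convex_setP cB AB; exact: smallest_sub. Qed.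

Lemma convex_hull_comb (A : set 'rV[R]_3) x y (a b : R) : 0 <= a -> 0 <= b -> a + b = 1 ->
  convex_hull A x -> convex_hull A y -> convex_hull A (a *: x + b *: y).
Proof.
move=> a0 b0 ab hx hy B [cB AB]; have -> : b = 1 - a by lra.
move/convex_setP: (cB) => /(_ x y a a0); apply; first by lra.
  by apply: hx.
by apply: hy.
Qed.

Lemma convex_hull_comb3 (A : set 'rV[R]_3) x y z (a b k : R) :
  0 <= a -> 0 <= b -> 0 <= k -> a + b + k = 1 ->
  convex_hull A x -> convex_hull A y -> convex_hull A z ->
  convex_hull A (a *: x + b *: y + k *: z).
Proof.
move=> a0 b0 k0 s hx hy hz.
have [ab0|ab0] := eqVneq (a + b) 0.
  have [-> -> ->] : [/\ a = 0, b = 0 & k = 1] by split; lra.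
  by rewrite !scale0r !add0r scale1r.
have abp : 0 < a + b by rewrite lt_neqAle eq_sym ab0 addr_ge0.
have -> : a *: x + b *: y + k *: z =
    (a + b) *: ((a / (a + b)) *: x + (b / (a + b)) *: y) + k *: z.
  by rewrite scalerDr !scalerA ![(a + b) * _]mulrC !divfK.
apply: convex_hull_comb => //; first exact: ltW.
apply: convex_hull_comb => //; try exact: divr_ge0 _ (ltW abp).
by rewrite -mulrDl divff.
Qed.

Lemma sum_ord3 (F : 'I_3 -> R) : \sum_i F i = F 0 + F 1 + F 2%:R.
Proof.
rewrite !big_ord_recl big_ord0 addr0 addrA.
by congr (_ + F _ + F _); exact/val_inj.
Qed.

Lemma sum3_eq0 (a b k : R) : [/\ 0 <= a, 0 <= b & 0 <= k] \/ [/\ a <= 0, b <= 0 & k <= 0] ->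
  a + b + k = 0 -> [/\ a = 0, b = 0 & k = 0].
Proof. by case=> -[h1 h2 h3] h; split; apply/eqP; rewrite eq_le; apply/andP; split; lra. Qed.

(** With coordinates in the basis [u], a point of the face satisfies
    [b = dot a x <= b * sum |x_i| <= b]. Equality holds in each coordinate, so the signs of [x] are
    those of [a], and [x_i = 0] wherever [a_i = 0]. *)
Lemma octahedral_frame (S : set 'rV[R]_3) : octahedral S ->
  exists e f n, ortho3 e f n /\ forall x, S x -> octant e f n x.
Proof.
move=> [P [F [G [[u [ou PE]] [[[a [b [a0 ab FE]]] _] _ _] H]]]].
have o : ortho3 (u 0) (u 1) (u 2%:R) by split; rewrite ?ou //; split; rewrite ou.
have uP i : P (u i) /\ P (- u i).
  by split; rewrite PE; apply: sub_gen_smallest; [left|right]; exists i.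
have abu i : `|dot a (u i)| <= b.
  by have [h1 h2] := uP i; rewrite ler_norml lerNl -dotNr !ab.
have P1 x : P x -> `|dot x (u 0)| + `|dot x (u 1)| + `|dot x (u 2%:R)| <= 1.
  rewrite PE -(sum_ord3 (fun i => `|dot x (u i)|)); move: x.
  apply: convex_hull_min => [x y k k0 k1 hx hy|_ [] [i _ <-]].
  - apply: le_trans (_ : \sum_i (k * `|dot x (u i)| + (1 - k) * `|dot y (u i)|) <= _).
      apply: ler_sum => i _; rewrite dotDl !dotZl; apply: le_trans (ler_normD _ _) _.
      by rewrite !normrM (ger0_norm k0) (ger0_norm (_ : 0 <= 1 - k)) // subr_ge0.
    rewrite big_split /= -!mulr_sumr; nra.
  - rewrite (bigD1 i) //= big1 ?addr0 ?ou ?eqxx ?normr1 // => j ji.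
    by rewrite ou eq_sym (negPf ji) normr0.
  - rewrite (bigD1 i) //= big1 ?addr0 ?dotNl ?ou ?eqxx ?normrN ?normr1 // => j ji.
    by rewrite dotNl ou eq_sym (negPf ji) oppr0 normr0.
have b0 : 0 < b.
  rewrite lt_neqAle (le_trans (normr_ge0 _) (abu 0)) andbT eq_sym; apply: contraNneq a0 => b0.
  have z i : dot a (u i) = 0.
    by apply/eqP; rewrite -normr_le0; have := abu i; rewrite b0.
  by apply/eqP; apply: (ortho3_coord _ _ _ _ o).
have sgn x i : F x -> 0 <= dot a (u i) * dot x (u i) /\ (dot a (u i) = 0 -> dot x (u i) = 0).
  rewrite FE => -[Px /= ax].
  have t j : dot a (u j) * dot x (u j) <= b * `|dot x (u j)|.
    apply: le_trans (ler_norm _) _; rewrite normrM ler_wpM2r //.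
  have := ax; rewrite (ortho3_dot _ _ _ a x o) => e.
  have hx := P1 x Px; have t0 := t 0; have t1 := t 1; have t2 := t 2%:R.
  have hb : b * (`|dot x (u 0)| + `|dot x (u 1)| + `|dot x (u 2%:R)|) <= b.
    by rewrite ler_piMr // ltW.
  have key : dot a (u i) * dot x (u i) = b * `|dot x (u i)|.
    have [->|->|->] : [\/ i = 0, i = 1 | i = 2%:R].
      case: i => [[|[|[|//]]] hi]; [constructor 1|constructor 2|constructor 3]; exact/val_inj.
    - lra.
    - lra.
    - lra.
  split; first by rewrite key mulr_ge0 // ltW.
  move=> z; move: key; rewrite z mul0r => /esym/eqP.
  by rewrite mulf_eq0 gt_eqF //= normr_eq0 => /eqP.
pose s i := if 0 <= dot a (u i) then u i else - u i.
have Fs x i : F x -> 0 <= dot x (s i).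
  move=> Fx; have [h1 h2] := sgn x i Fx; rewrite /s; case: (ltrgtP 0 (dot a (u i))) => h.
  - by rewrite -(pmulr_rge0 _ h).
  - by rewrite dotNr oppr_ge0 -(nmulr_rge0 _ h).
  - by rewrite h2.
have cFs x i : closure F x -> 0 <= dot x (s i).
  move=> cx; rewrite leNgt; apply/negP => h.
  have h' : 0 < dot x (- s i) by rewrite dotNr oppr_gt0.
  have [eta eta0 near] := dot_near _ _ h'.
  have [y [Fy hy]] := cx _ (nbhs_enorm x _ eta0).
  have := near y (- s i) hy; rewrite subrr /enorm dot0l sqrtr0 => /(_ eta0).
  by rewrite dotNr oppr_gt0 ltNge Fs.
(* Only a nonzero common point of the line and the face transfers its signs to [x]. *)
have cF0 x : closure F x -> x != 0.
  move=> cx; apply/eqP => x0.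
  have [y [Fy hy]] := cx _ (nbhs_enorm x (b / (enorm a + 1)) (divr_gt0 b0 (ltr_wpDl (enorm_ge0 a) ltr01))).
  have : dot a y = b by move: Fy; rewrite FE => -[].
  have := dot_le_enorm a y; move: hy; rewrite /= x0 subr0 ltr_pdivlMr; last first.
    exact: ltr_wpDl (enorm_ge0 a) ltr01.
  have := enorm_ge0 y; nra.
exists (s 0), (s 1), (s 2%:R); split.
  have ss i : dot (s i) (s i) = 1 by rewrite /s; case: ifP; rewrite ?dotNl ?dotNr ?opprK ou eqxx.
  have sij i j : i != j -> dot (s i) (s j) = 0.
    by move=> ij; rewrite /s; do 2!case: ifP => _; rewrite ?dotNl ?dotNr ou (negPf ij) ?oppr0.
  by split=> //; split; exact: sij.
move=> x Sx; have [[y [[t _ yE] cFy]] _] : range (fun t : R => t *: x) `&` closure F !=set0 /\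
    range (fun t : R => t *: x) `&` closure G !=set0 by apply: H; exists x.
have t0 : t != 0 by apply: contraNneq (cF0 y cFy) => t0; rewrite -yE t0 scale0r.
have xy g : dot x g = t^-1 * dot y g by rewrite -yE dotZl mulKf.
rewrite /octant !xy; case: (ltrgtP t 0) t0 => // ht _; [right|left].
  by split; rewrite mulr_le0_ge0 ?cFs // invr_le0 ltW.
by split; rewrite mulr_ge0 ?cFs // invr_ge0 ltW.
Qed.

(** The face is cut out by [a = e + f + n]. A vector of the double octant is scaled onto it by the
    sum [m] of its coordinates, which have a common sign and do not all vanish. *)
Lemma frame_octahedral (S : set 'rV[R]_3) e f n : ortho3 e f n ->
  (forall x, S x -> x != 0 /\ octant e f n x) -> octahedral S.
Proof.
move=> o H; have [ee ff nn [ef en fn]] := o.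
pose u (i : 'I_3) := nth 0 [:: e; f; n] i.
have ou : orthonormal_basis u.
  case=> [[|[|[|//]]] hi] [[|[|[|//]]] hj]; rewrite /u //=; by rewrite // dotC.
pose P := convex_hull (range u `|` range (fun i => - u i)).
pose a := e + f + n.
have uP i : P (u i) by apply: sub_gen_smallest; left; exists i.
have [eP fP nP] : [/\ P e, P f & P n].
  by split; [exact: (uP 0)|exact: (uP 1)|exact: (uP (@Ordinal 3 2 isT))].
have PN x : P x -> P (- x).
  move: x; apply: convex_hull_min => [x y k k0 k1 hx hy|_ [] [i _ <-]].
  - by rewrite opprD -!scalerN; apply: convex_hull_comb; rewrite ?subr_ge0 // subrKC.
  - by apply: sub_gen_smallest; right; exists i.
  - by rewrite opprK.
have au i : dot a (u i) = 1.
  case: i => [[|[|[|//]]] hi]; rewrite /u /a /= !dotL ?ee ?ff ?nn ?ef ?en ?fn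
    ?(dotC f e) ?(dotC n e) ?(dotC n f) ?ef ?en ?fn; ring.
have aP x : P x -> dot a x <= 1.
  move: x; apply: convex_hull_min => [x y k k0 k1 hx hy|_ [] [i _ <-]].
  - by rewrite dotDr !dotZr; nra.
  - by rewrite au.
  - by rewrite dotNr au; lra.
have aP' x : P x -> dot (- a) x <= 1 by move=> /PN/aP; rewrite dotNl dotNr.
have a0 : a != 0 by apply: (@dot_neq0l _ _ e); rewrite (au 0) oner_eq0.
(* The sign [s] serves the face and its opposite at once; an explicit right inverse has the columns
   [s *: f] and [s *: n]. *)
have rf (s : R) : s * s = 1 -> row_free (col_mx (s *: f - s *: e) (s *: n - s *: e)).
  move=> ss; apply/row_freeP; exists (row_mx (s *: f)^T (s *: n)^T).
  rewrite mul_col_row (scalar_mx_block 1 1 (1 : R)).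
  have D x y : x *m y^T = (dot x y)%:M by rewrite [LHS]mx11_scalar.
  rewrite !D !dotL ?ee ?ff ?nn ?ef ?en ?fn ?(dotC n f) ?fn.
  rewrite !(mulr0, mulr1, subr0, sub0r, oppr0) ?opprK ss ?subr0.
  by congr block_mx; rewrite -[RHS](raddf0 (@scalar_mx R 1)); congr _%:M; ring.
pose F := P `&` [set x | dot a x = 1].
have fF : is_face P F.
  split; first by exists a, 1.
  exists e, f, n; split.
  - by split=> //; exact: (au 0).
  - by split=> //; exact: (au 1).
  - by split=> //; exact: (au (@Ordinal 3 2 isT)).
  by have := rf 1 (mulr1 1); rewrite !scale1r.
have fG : is_face P [set - x | x in F].
  split.
    exists (- a), 1; split; rewrite ?oppr_eq0 //; apply/seteqP; split=> [_ [x [Px ax] <-]|x [Px ax]].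
      by split; [exact: PN|rewrite /= dotNl dotNr opprK].
    exists (- x); last by rewrite opprK.
    by split; [exact: PN|rewrite /= dotNr -dotNl].
  exists (- e), (- f), (- n); split.
  - by exists e => //; split=> //; exact: (au 0).
  - by exists f => //; split=> //; exact: (au 1).
  - by exists n => //; split=> //; exact: (au (@Ordinal 3 2 isT)).
  have := rf (-1); rewrite !scaleN1r; apply; ring.
exists P, F, [set - x | x in F]; split=> //; first by exists u.
move=> _ [x Sx <-]; have [x0 ox] := H x Sx.
pose m := dot x e + dot x f + dot x n.
have xE := ortho3_exp _ _ _ x o.
have m0 : m != 0 /\ [/\ 0 <= dot x e / m, 0 <= dot x f / m & 0 <= dot x n / m].
  have m0 : m != 0.
    apply/eqP => m0; move/eqP: x0; apply; have [z1 z2 z3] := sum3_eq0 _ _ _ ox m0.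
    exact: ortho3_coord o z1 z2 z3.
  split=> //; case: ox => -[h1 h2 h3].
    by split; rewrite divr_ge0 // /m !addr_ge0.
  have im : m^-1 <= 0 by rewrite invr_le0 /m; move: h1 h2 h3; lra.
  by split; apply: mulr_le0.
case: m0 => m0 [c1 c2 c3].
have Fx : F (m^-1 *: x).
  split.
    rewrite xE !scalerDr !scalerA ![m^-1 * _]mulrC.
    apply: convex_hull_comb3 => //.
    by rewrite -!mulrDl divff.
  rewrite /= dotZr /a !dotDl (dotC e) (dotC f) (dotC n).
  by rewrite mulVf.
split; [exists (m^-1 *: x)|exists (- (m^-1 *: x))]; split.
- by exists m^-1.
- exact: subset_closure.
- by exists (- m^-1) => //; rewrite scaleNr.
- by apply: subset_closure; exists (m^-1 *: x).
Qed.

End Octahedra.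

(** * Three double octants do not cover the sphere *)

Section Covers.
Context {R : realType}.
Implicit Types (u v w x y z e f n g p q : 'rV[R]_3).

Lemma dot_near_l x g : 0 < dot x g -> exists2 eta, 0 < eta &
  forall y, enorm (y - x) < eta -> 0 < dot y g.
Proof.
move=> h; have [eta e0 near] := dot_near _ _ h; exists eta => // y hy.
by apply: near => //; rewrite subrr /enorm dot0l sqrtr0.
Qed.

(** Outside the double octant some coordinate is positive and some is negative, which is an open
    condition. *)
Lemma octant_open e f n x : ~ octant e f n x -> exists2 eta, 0 < eta &
  forall y, enorm (y - x) < eta -> ~ octant e f n y.
Proof.
move=> no.
have [g [g' [hg hg' out]]] : exists g g', [/\ 0 < dot x g, 0 < dot x (- g') &
    forall y, 0 < dot y g -> 0 < dot y (- g') -> ~ octant e f n y].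
  have ex (P : 'rV[R]_3 -> Prop) : (~ P e /\ ~ P f /\ ~ P n -> False) ->
      exists g, P g /\ (g = e \/ g = f \/ g = n).
    move=> h; apply: contrapT => h'; apply: h.
    by split; [|split] => hP; apply: h'; [exists e|exists f|exists n]; intuition.
  have [g [hg gin]] : exists g, 0 < dot x g /\ (g = e \/ g = f \/ g = n).
    by apply: ex; rewrite !ltNge => -[h1 [h2 h3]]; apply: no; right; split; apply: contrapT => /negP.
  have [g' [hg' gin']] : exists g, dot x g < 0 /\ (g = e \/ g = f \/ g = n).
    by apply: ex; rewrite !ltNge => -[h1 [h2 h3]]; apply: no; left; split; apply: contrapT => /negP.
  exists g, g'; split=> //; first by rewrite dotNr oppr_gt0.
  move=> y; rewrite dotNr oppr_gt0 !ltNge => /negP h1 /negP h2 [[k1 k2 k3]|[k1 k2 k3]].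
    by case: gin' => [|[]] e'; apply: h2; rewrite e'.
  by case: gin => [|[]] e'; apply: h1; rewrite e'.
have [e1 e10 h1] := dot_near_l _ _ hg; have [e2 e20 h2] := dot_near_l _ _ hg'.
exists (Num.min e1 e2); first by rewrite lt_min e10.
by move=> y; rewrite lt_min => /andP[y1 y2]; apply: out; [exact: h1|exact: h2].
Qed.

Lemma octantN e f n x : octant e f n x -> octant e f n (- x).
Proof.
by rewrite /octant !dotNl !oppr_ge0 !oppr_le0 => -[[h1 h2 h3]|[h1 h2 h3]]; [right|left].
Qed.

(** The supremum of the parameters in [A] belongs to [A], hence not to [B]; slightly beyond it
    neither set is available. *)
Lemma segment_split (A B : 'rV[R]_3 -> Prop) p q :
  (forall x, ~ A x -> exists2 eta, 0 < eta & forall y, enorm (y - x) < eta -> ~ A y) ->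
  (forall x, ~ B x -> exists2 eta, 0 < eta & forall y, enorm (y - x) < eta -> ~ B y) ->
  (forall t : R, 0 <= t -> t <= 1 -> A (p + t *: q) \/ B (p + t *: q)) ->
  (forall t : R, 0 <= t -> t <= 1 -> ~ (A (p + t *: q) /\ B (p + t *: q))) ->
  A p -> ~ A (p + q) -> False.
Proof.
move=> oA oB cov dis Ap Aq.
pose T := [set t : R | [/\ 0 <= t, t <= 1 & A (p + t *: q)]].
have T0 : T 0 by split; rewrite ?scale0r ?addr0 ?ler01.
have sT : has_sup T by split; [exists 0|exists 1 => t []].
pose t := sup T.
have t0 : 0 <= t by apply: ub_le_sup => //; case: sT.
have t1 : t <= 1 by apply: ge_sup; [exists 0|move=> s []].
have close s (eta : R) : 0 < eta -> `|s - t| < eta / (enorm q + 1) ->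
    enorm (p + s *: q - (p + t *: q)) < eta.
  move=> e0; rewrite opprD addrACA subrr add0r -scalerBl enormZ ltr_pdivlMr; last exact: ltr_wpDl (enorm_ge0 q) ltr01.
  apply: le_lt_trans; rewrite ler_wpM2l // lerDl ler01 //.
have pos (eta : R) : 0 < eta -> 0 < eta / (enorm q + 1).
  by move=> e0; rewrite divr_gt0 // ltr_wpDl ?enorm_ge0.
have At : A (p + t *: q).
  apply: contrapT => /oA[eta e0 near].
  have [s [s0 s1 As] hs] := sup_adherent (pos _ e0) sT.
  apply: (near (p + s *: q)) => //; apply: close => //.
  have st : s <= t by apply: ub_le_sup; [case: sT|split].
  by rewrite distrC ger0_norm ?subr_ge0 // /t; lra.
have /oB[eta e0 near] : ~ B (p + t *: q) by move=> Bt; apply: (dis t).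
have t1' : t < 1.
  rewrite lt_neqAle t1 andbT; apply/eqP => t1'; apply: Aq.
  by rewrite t1' scale1r in At.
pose h := Num.min (1 - t) (eta / (enorm q + 1) / 2).
have h0 : 0 < h by rewrite lt_min subr_gt0 t1' divr_gt0 // pos.
have [h1 h2] : h <= 1 - t /\ h <= eta / (enorm q + 1) / 2 by rewrite !ge_min !lexx orbT.
have := pos _ e0 => pe.
have [] := cov (t + h); [lra|lra| |].
  move=> Ah; have : t + h <= t by apply: ub_le_sup; [case: sT|split=> //; lra].
  lra.
apply: near; apply: close => //; rewrite addrC addKr gtr0_norm //; lra.
Qed.

(** Along this moment curve the product with [g] is a polynomial in [a] whose coefficients are the
    coordinates of [g], so it is nonzero. *)
Lemma generic_combination e f n (gs : seq 'rV[R]_3) : ortho3 e f n ->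
  all (fun g => g != 0) gs ->
  exists2 a : R, 0 < a & all (fun g => dot (e + a *: f + a ^+ 2 *: n) g != 0) gs.
Proof.
move=> o g0; pose P g : {poly R} := (dot e g)%:P + (dot f g) *: 'X + (dot n g) *: 'X^2.
have Pa g a : (P g).[a] = dot (e + a *: f + a ^+ 2 *: n) g.
  by rewrite /P !hornerD !hornerZ hornerC hornerX hornerXn !dotL; ring.
have P0 g : g != 0 -> P g != 0.
  apply: contraNneq => Pg.
  have c k := congr1 (fun p : {poly R} => p`_k) Pg.
  have := c 0%N; have := c 1%N; have := c 2%N; rewrite /P !coefE /= !(mulr0, mulr1, addr0, add0r).
  by move=> h1 h2 h3; apply/eqP; apply: (ortho3_coord _ _ _ _ o); rewrite dotC.
pose Q := \prod_(g <- gs) P g.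
have Q0 : Q != 0.
  rewrite /Q; elim: (gs) g0 => [|g l IH]; first by rewrite big_nil oner_eq0.
  by rewrite big_cons /= => /andP[h1 h2]; rewrite mulf_neq0 ?P0 ?IH.
(* These are [size Q] distinct positive candidates, one more than the degree of [Q]. *)
pose rs := [seq i.+1%:R : R | i <- iota 0 (size Q)].
have /allPn[a ars Qa] : ~~ all (root Q) rs.
  apply/negP => h; have := max_poly_roots Q0 h.
  rewrite size_map size_iota ltnn map_inj_uniq ?iota_uniq; first by move/(_ isT).
  by move=> i j /eqP; rewrite eqr_nat eqSS => /eqP.
exists a; first by case/mapP: ars => i _ ->; rewrite ltr0n.
move: Qa; rewrite /root /Q horner_prod prodf_seq_neq0 => /allP h.
by apply/allP => g /h; rewrite Pa.
Qed.

(** With signs normalized, a zero dot product of nonnegative coordinates means disjoint supports. In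
    three coordinates one of [x], [y] is then a multiple of a frame vector, which [m] is not
    orthogonal to. *)
Lemma octant_generic_perp e f n m x y : ortho3 e f n ->
  dot m e != 0 -> dot m f != 0 -> dot m n != 0 -> x != 0 -> y != 0 ->
  dot m x = 0 -> dot m y = 0 -> dot x y = 0 -> octant e f n x -> octant e f n y -> False.
Proof.
move=> o me mf mn x0 y0.
wlog hx : x x0 / [/\ 0 <= dot x e, 0 <= dot x f & 0 <= dot x n].
  move=> W mx my xy ox oy; case: (ox) => h; first exact: (W x).
  apply: (W (- x)); rewrite ?oppr_eq0 ?dotNr ?dotNl ?mx ?xy ?oppr0 //.
    by case: h => h1 h2 h3; split; rewrite ?dotNl oppr_ge0.
  exact: octantN.
wlog hy : y y0 / [/\ 0 <= dot y e, 0 <= dot y f & 0 <= dot y n].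
  move=> W mx my xy ox oy; case: (oy) => h; first exact: (W y).
  apply: (W (- y)); rewrite ?oppr_eq0 ?dotNr ?dotNl ?my ?xy ?oppr0 //.
    by case: h => h1 h2 h3; split; rewrite ?dotNl oppr_ge0.
  exact: octantN.
move=> mx my xy _ _; case: hx => x1 x2 x3; case: hy => y1 y2 y3.
have Ex := ortho3_exp _ _ _ x o; have Ey := ortho3_exp _ _ _ y o.
rewrite (ortho3_dot _ _ _ x y o) in xy.
have nn z : z != 0 -> dot m z = 0 -> 
    (dot z e = 0 -> dot z f = 0 -> False) /\ (dot z e = 0 -> dot z n = 0 -> False) /\
    (dot z f = 0 -> dot z n = 0 -> False).
  move=> z0 mz; have Ez := ortho3_exp _ _ _ z o.
  have key (k : R) g : dot m g != 0 -> z = k *: g -> False.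
    move=> mg zg; move: mz z0; rewrite zg dotZr => /eqP; rewrite mulf_eq0 (negPf mg) orbF => /eqP ->.
    by rewrite scale0r eqxx.
  split; [|split] => h1 h2; move: Ez; rewrite h1 h2 !scale0r ?add0r ?addr0; exact: key.
have [a1 [a2 a3]] := nn x x0 mx; have [b1 [b2 b3]] := nn y y0 my.
have p1 := mulr_ge0 x1 y1; have p2 := mulr_ge0 x2 y2; have p3 := mulr_ge0 x3 y3.
have z1 : dot x e * dot y e = 0 by move: p1 p2 p3 xy; clear; lra.
have z2 : dot x f * dot y f = 0 by move: p1 p2 p3 xy; clear; lra.
have z3 : dot x n * dot y n = 0 by move: p1 p2 p3 xy; clear; lra.
move/eqP: z1; move/eqP: z2; move/eqP: z3; rewrite !mulf_eq0.
by move=> /orP[]/eqP h1 /orP[]/eqP h2 /orP[]/eqP h3; auto.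
Qed.

(** Positive coefficients keep the plane orthogonal to [m] off the first double octant, and
    genericity forbids orthogonal pairs inside either of the others. A quarter turn therefore
    exchanges these two, which makes them disjoint and both nonempty on a connected path. *)
Lemma three_octants e1 f1 n1 e2 f2 n2 e3 f3 n3 :
  ortho3 e1 f1 n1 -> ortho3 e2 f2 n2 -> ortho3 e3 f3 n3 ->
  exists x, [/\ x != 0, ~ octant e1 f1 n1 x, ~ octant e2 f2 n2 x & ~ octant e3 f3 n3 x].
Proof.
move=> o1 o2 o3; apply: contrapT => H.
have unit0 (w : 'rV[R]_3) : dot w w = 1 -> w != 0.
  by move=> h; rewrite -dotxx_gt0 h ltr01.
have [ee1 ff1 nn1 [ef1 en1 fn1]] := o1.
have [a a0 /=] : exists2 a : R, 0 < a & all (fun g => dot (e1 + a *: f1 + a ^+ 2 *: n1) g != 0)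
    [:: e2; f2; n2; e3; f3; n3].
  apply: generic_combination => //=.
  by case: o2 => h1 h2 h3 _; case: o3 => h4 h5 h6 _; rewrite !unit0.
have [m mE] : exists m, m = e1 + a *: f1 + a ^+ 2 *: n1 by eexists.
rewrite -mE => /and5P[me2 mf2 mn2 me3 /andP[mf3 /andP[mn3 _]]].
have cov x : x != 0 -> dot m x = 0 -> octant e2 f2 n2 x \/ octant e3 f3 n3 x.
  move=> x0 mx; apply: contrapT => /not_orP[h2 h3]; apply: H; exists x; split=> // ox.
  have aa : 0 < a ^+ 2 by rewrite exprn_gt0.
  have sum0 : dot x e1 + a * dot x f1 + a ^+ 2 * dot x n1 = 0.
    by rewrite -mx mE !dotL (dotC e1) (dotC f1) (dotC n1).
  have ox' : [/\ 0 <= dot x e1, 0 <= a * dot x f1 & 0 <= a ^+ 2 * dot x n1] \/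
             [/\ dot x e1 <= 0, a * dot x f1 <= 0 & a ^+ 2 * dot x n1 <= 0].
    by case: ox => -[? ? ?]; [left|right]; rewrite !(pmulr_rge0, pmulr_rle0).
  have [z1 z2 z3] := sum3_eq0 _ _ _ ox' sum0.
  move/eqP: x0; apply; apply: (ortho3_coord _ _ _ _ o1 z1).
    by move/eqP: z2; rewrite mulf_eq0 gt_eqF //= => /eqP.
  by move/eqP: z3; rewrite mulf_eq0 gt_eqF //= => /eqP.
have m0 : m != 0 by apply: dot_neq0l me2.
have [p [q [_ pp qq [mp mq pq]]]] := ortho3_extend (unitv m) (dot_unitv m m0).
have perp x : dot (unitv m) x = 0 -> dot m x = 0 by move=> h; rewrite -(unitvK m m0) dotZl h mulr0.
have {}mp := perp _ mp; have {}mq := perp _ mq.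
have seg (s t : R) : s ^+ 2 + t ^+ 2 != 0 -> 
    [/\ s *: p + t *: q != 0, dot m (s *: p + t *: q) = 0,
        (octant e2 f2 n2 (s *: p + t *: q) \/ octant e3 f3 n3 (s *: p + t *: q)) &
      ~ (octant e2 f2 n2 (s *: p + t *: q) /\ octant e3 f3 n3 (s *: p + t *: q))].
  move=> st.
  have nz (s' t' : R) : s' ^+ 2 + t' ^+ 2 != 0 -> s' *: p + t' *: q != 0.
    by move=> h; rewrite -dotxx_eq0 !dotL pp qq (dotC q) pq !(mulr0, mulr1, addr0, add0r) -!expr2.
  have mz (s' t' : R) : dot m (s' *: p + t' *: q) = 0 by rewrite !dotL mp mq !mulr0 addr0.
  split; [exact: nz|exact: mz|by apply: cov; [exact: nz|exact: mz]|].
  (* [y] is the quarter turn of the point in the plane; whichever octant contains [y] would hold an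
     orthogonal pair. *)
  move=> [h2 h3]; pose y := (- t) *: p + s *: q.
  have y0 : y != 0 by apply: nz; rewrite sqrrN addrC.
  have xy : dot (s *: p + t *: q) y = 0.
    by rewrite /y !dotL pp qq (dotC q) pq; ring.
  case: (cov y y0 (mz _ _)) => hy.
    exact: octant_generic_perp o2 me2 mf2 mn2 (nz _ _ st) y0 (mz _ _) (mz _ _) xy h2 hy.
  exact: octant_generic_perp o3 me3 mf3 mn3 (nz _ _ st) y0 (mz _ _) (mz _ _) xy h3 hy.
have p0 := unit0 _ pp; have q0 := unit0 _ qq.
have path (t : R) : p + t *: (q - p) = (1 - t) *: p + t *: q.
  by apply/rowP => k; rewrite !mxE; ring.
have pos (t : R) : (1 - t) ^+ 2 + t ^+ 2 != 0.
  rewrite gt_eqF //; have -> : (1 - t) ^+ 2 + t ^+ 2 = 2 * (t - 1 / 2) ^+ 2 + 1 / 2 by field.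
  by rewrite ltr_wpDl // ?divr_gt0 // mulr_ge0 // sqr_ge0.
have pq' : p + (q - p) = q by rewrite addrC subrK.
case: (cov p p0 mp) => hp.
  apply: (@segment_split (octant e2 f2 n2) (octant e3 f3 n3) p (q - p)) => //.
  - exact: octant_open.
  - exact: octant_open.
  - by move=> t _ _; rewrite path; case: (seg _ _ (pos t)).
  - by move=> t _ _; rewrite path; case: (seg _ _ (pos t)).
  rewrite pq' => hq; exact: octant_generic_perp o2 me2 mf2 mn2 p0 q0 mp mq pq hp hq.
apply: (@segment_split (octant e3 f3 n3) (octant e2 f2 n2) p (q - p)) => //.
- exact: octant_open.
- exact: octant_open.
- by move=> t _ _; rewrite path; case: (seg _ _ (pos t)) => _ _ []; auto.
- by move=> t _ _; rewrite path; case: (seg _ _ (pos t)) => _ _ _ h [h1 h2]; apply: h.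
rewrite pq' => hq; exact: octant_generic_perp o3 me3 mf3 mn3 p0 q0 mp mq pq hp hq.
Qed.

End Covers.

(** * Octahedral colorings are dominated *)

Section OctahedralDominated.
Context {R : realType}.
Implicit Types (u v w x y z e f n g p q : 'rV[R]_3).

Lemma octantZ e f n (a : R) x : 0 < a -> octant e f n (a *: x) -> octant e f n x.
Proof.
move=> a0; rewrite /octant !dotZl => -[] [].
  by rewrite !(pmulr_rge0 _ a0) => h1 h2 h3; left.
by rewrite !(pmulr_rle0 _ a0) => h1 h2 h3; right.
Qed.

(** A point outside the other three double octants must have color [i]. Such points in the open
    positive octant of frame [i] form a relatively open subset of the class itself, so a great
    circle meeting it meets the class. *)
Lemma octahedral_dominated (S : 'I_4 -> set 'rV[R]_3) : orthogonal_coloring S ->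
  (forall i, octahedral (S i)) -> forall i, exists D, dominates D (S i).
Proof.
move=> hS oct i.
have /choice[E /choice[F /choice[N H]]] : forall i, exists e, exists f, exists n,
    ortho3 e f n /\ forall x, S i x -> octant e f n x.
  by move=> j; exact: octahedral_frame.
have o j : ortho3 (E j) (F j) (N j) by case: (H j).
have SO j x : S j x -> octant (E j) (F j) (N j) x by case: (H j) => _; apply.
pose good x := [/\ 0 < dot x (E i), 0 < dot x (F i) & 0 < dot x (N i)] /\
  forall j, j != i -> ~ octant (E j) (F j) (N j) x.
have goodZ x (a : R) : 0 < a -> good x -> good (a *: x).
  move=> a0 [[h1 h2 h3] h]; split; first by rewrite !dotZl !mulr_gt0.
  by move=> j /h hj /(octantZ _ _ _ _ _ a0).
have others x : dot x x = 1 -> (forall j, j != i -> ~ octant (E j) (F j) (N j) x) -> S i x.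
  move=> xx h; have [j Sj] := coloring_cover _ hS _ xx.
  by have [<-//|/h] := eqVneq j i; case; exact: SO.
have stay x : (forall m, m != i -> ~ octant (E m) (F m) (N m) x) -> exists2 eta, 0 < eta &
    forall y, enorm (y - x) < eta -> forall m, m != i -> ~ octant (E m) (F m) (N m) y.
  move=> nx; have op m : exists eta, 0 < eta /\ forall y, enorm (y - x) < eta ->
      m != i -> ~ octant (E m) (F m) (N m) y.
    have [->|mi] := eqVneq m i; first by exists 1.
    by have [eta e0 h] := octant_open _ _ _ _ (nx m mi); exists eta; split=> // y /h.
  have /choice[r hr] := op.
  exists (\big[Num.min/1]_m r m).
    by elim/big_rec: _ => // m y _ y0; rewrite lt_min y0 (hr m).1.
  move=> y hy m; apply: (hr m).2; apply: lt_le_trans hy _.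
  by rewrite (bigD1 m) //= ge_min lexx.
exists (@sphere R `&` good); split.
- pose k : 'I_4 := if i == 0 then 1 else 0.
  have ik : i != k by rewrite /k; have [->|] := eqVneq i 0.
  have [j [l [_ [_ _ _ _] cov]]] := ord4_others _ _ ik.
  have [x0 [x00 nk nj nl]] := three_octants _ _ _ _ _ _ _ _ _ (o k) (o j) (o l).
  have nx0 m : m != i -> ~ octant (E m) (F m) (N m) x0.
    by move=> mi; have := cov m; rewrite (negPf mi) /= => /or3P[]/eqP ->.
  have pn : 0 < (enorm x0)^-1 by rewrite invr_gt0 enorm_gt0.
  have ox0 : octant (E i) (F i) (N i) x0.
    apply: (octantZ _ _ _ _ _ pn); apply: SO; apply: others; first exact: dot_unitv.
    by move=> m /nx0 h /(octantZ _ _ _ _ _ pn).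
  (* [good] refers to the positive octant only, so the point may have to be replaced by its
     antipode; a small push along the diagonal [w] then makes its coordinates strictly positive. *)
  have [x [xi nx]] : exists x, [/\ 0 <= dot x (E i), 0 <= dot x (F i) & 0 <= dot x (N i)] /\
      forall m, m != i -> ~ octant (E m) (F m) (N m) x.
    case: ox0 => h; first by exists x0.
    exists (- x0); split; first by rewrite !dotNl !oppr_ge0.
    by move=> m /nx0 hm /octantN; rewrite opprK.
  have [eta eta0 near] := stay _ nx.
  pose w := E i + F i + N i.
  have [a a0 ha] : exists2 a : R, 0 < a & a * enorm w < eta.
    exists (eta / (enorm w + 1)); first by rewrite divr_gt0 // ltr_wpDl ?enorm_ge0.
    by rewrite mulrAC ltr_pdivrMr ?ltr_wpDl ?enorm_ge0 // ltr_pM2l // ltrDl.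
  have gx : good (x + a *: w).
    split; last by apply: near; rewrite addrC addKr enormZ gtr0_norm.
    have [ee ff nn [ef en fn]] := o i; have [h1 h2 h3] := xi.
    split; rewrite dotDl dotZl /w !dotDl ?ee ?ff ?nn ?ef ?en ?fn ?(dotC (F i) (E i))
      ?(dotC (N i) (E i)) ?(dotC (N i) (F i)) ?ef ?en ?fn !(addr0, add0r) mulr1 ltr_wpDl //.
  have y0 : x + a *: w != 0 by case: gx => -[h _ _] _; apply: dot_neq0l; rewrite gt_eqF; [|exact: h].
  exists (unitv (x + a *: w)); split; first exact: dot_unitv.
  by apply: goodZ => //; rewrite invr_gt0 enorm_gt0.
- by move=> x [].
- apply/open_subspaceP; exists good; last first.
    by apply/seteqP; split=> x; [case=> gx sx|case=> -[sx gx] _].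
  rewrite openE => x [[h1 h2 h3] h].
  have pos g : 0 < dot x g -> nbhs x [set y | 0 < dot y g].
    by move=> /dot_near_l[eta e0 near]; apply: filterS (nbhs_enorm x eta e0) => y; exact: near.
  have out : nbhs x [set y | forall j, j != i -> ~ octant (E j) (F j) (N j) y].
    by have [eta e0 near] := stay _ h; apply: filterS (nbhs_enorm x eta e0) => y; exact: near.
  apply: filterS (filterI (filterI (pos _ h1) (pos _ h2)) (filterI (pos _ h3) out)).
  by move=> y [[? ?] [? ?]].
- move=> C _ [u [Cu [Su [_ gu]]]]; exists u; split=> //; exact: others.
Qed.

End OctahedralDominated.

Theorem theorem1 (R : realType) (S : 'I_4 -> set 'rV[R]_3)
    (hS : orthogonal_coloring S) :
  octahedral_coloring S <->
  (forall i : 'I_4, exists D : set 'rV[R]_3, dominates D (S i)).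
Proof.
split=> [oct i|dom i]; first exact: octahedral_dominated.
have [e [f [n [o SO]]]] := dominated_frame S hS dom i.
apply: (frame_octahedral _ _ _ _ o) => x Sx; split; last exact: SO.
by rewrite -dotxx_gt0 (coloring_sphere _ hS _ _ Sx) ltr01.
Qed.
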